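(* Let $G$ be the split simply connected group of type $E_6$ over $k$, $V$ its 27-dimensional irreducible representation with highest weight $\omega_1$, $\Gamma_V$ the associated geometry of subspaces of $V$, and $\phi$ the automorphism of $G$ of order 2 induced by the nontrivial automorphism of the Dynkin diagram. For each subspace $X$ of $V$ put $$\psi(X) := \{\, y \in V \mid \{X, y, V\} \subseteq X \,\},$$ where $\{\ ,\ ,\ \}$ is the brace product on $V$. Then $\psi(V_\delta) = V_{\phi(\delta)}$ for every $\delta\in\Delta$, and the restriction of $\psi$ to $\Gamma_V$ is the automorphism of the geometry $\Gamma_V$ induced by the automorphism $\phi$ of $G$.
   Context: $k$ is a field of characteristic zero. The simple roots $\Delta=\{\alpha_1,\dots,\alpha_6\}$ of $E_6$ are numbered as in Bourbaki: the diagram is the chain $\alpha_1 - \alpha_3 - \alpha_4 - \alpha_5 - \alpha_6$ with $\alpha_2$ joined to $\alpha_4$; $\omega_i$ is the fundamental weight corresponding to $\alpha_i$. $T\subset B$ are the standard split maximal torus and Borel subgroup, $\mathfrak X_\rho$ is the root subgroup of a root $\rho$, and $P_\delta$ ($\delta\in\Delta$) is the maximal parabolic generated by $B$ and the $\mathfrak X_{-\alpha}$, $\alpha\in\Delta\setminus\{\delta\}$. Let $v^+\in V$ be a highest weight vector and $\beta=\alpha_1$. Put $V_{\alpha_1}=kv^+$. For $\delta\neq\alpha_1$, let $L_\delta$ be the subgroup of $G$ generated by the $\mathfrak X_\rho$ for roots $\rho$ that are combinations of simple roots in the connected component of $\alpha_1$ in the diagram with $\delta$ removed, and let $V_\delta$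 be the span of the $L_\delta$-orbit of $v^+$. The objects of $\Gamma_V$ are the subspaces $gV_\delta$ ($g\in G(k)$, $\delta\in\Delta$); $gV_\delta$ has type $\delta$, its stabilizer in $G$ is $gP_\delta g^{-1}$, and sending an object to its stabilizer is a bijection onto the set of maximal proper parabolic subgroups of $G$. Two objects are incident if the intersection of their stabilizers contains a parabolic subgroup. The automorphism of $\Gamma_V$ induced by $\phi$ sends the object with stabilizer $P$ to the object with stabilizer $\phi(P)$. $\phi$ preserves $T$ and $B$, exchanges $\alpha_1\leftrightarrow\alpha_6$, $\alpha_3\leftrightarrow\alpha_5$ and fixes $\alpha_2,\alpha_4$ (it sends $x_{\pm\alpha}(t)$ to $x_{\pm\phi(\alpha)}(t)$ for $\alpha\in\Delta$). $b$ is a nonzero bilinear form on $V$ with $b(\phi(g)x, gy) = b(x,y)$ for all $g\in G$, $x,y\in V$ (it is unique up to scalar, symmetric and nondegenerate). $N$ is a nonzero $G$-invariant cubic form on $V$ (unique up to scalar), and $N(\,,\,,\,)$ is also the symmetric trilinear form with $N(x,x,x)=6N(x)$. The symmetric bilinear product $\#$ on $V$ is defined by $b(x\# y, z) = N(x,y,z)$, and $x^\# := (x\# x)/2$. The scalars are chosen so that the adjoint identity $x^{\#\#}=N(x)x$ holds for all $x\in V$. The brace product is $$\{x,y,z\} := b(x,y)z + b(z,y)x - (x\# z)\# y .$$ *)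

(* Defs.v *)
From HB Require Import structures.
From mathcomp Require Import all_boot all_order all_fingroup all_algebra.
From mathcomp Require Import boolp classical_sets functions.

Set Implicit Arguments.
Unset Strict Implicit.
Unset Printing Implicit Defensive.

Import GRing.Theory.
Local Open Scope classical_set_scope.
Local Open Scope ring_scope.

(* The simple root alpha_n in Bourbaki's numbering, 1 <= n <= 6; the ordinal
   of value i stands for alpha_(i+1). *)
Definition alpha (n : nat) : 'I_6 := inord n.-1.

Definition E6_edges : seq (nat * nat) :=
  [:: (1, 3); (3, 4); (4, 5); (5, 6); (2, 4)]%N.

Definition adjacent : rel 'I_6 := fun i j =>
  ((i.+1, j.+1) \in E6_edges) || ((j.+1, i.+1) \in E6_edges).

Definition cartan (i j : 'I_6) : int :=
  if i == j then 2 else if adjacent i j then -1 else 0.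

(* The nontrivial automorphism of the diagram. *)
Definition sigma : {perm 'I_6} :=
  (tperm (alpha 1) (alpha 6) * tperm (alpha 3) (alpha 5))%g.

(* For delta != alpha 1: the connected component of alpha 1 in the diagram
   with delta removed. *)
Definition component (delta : 'I_6) : pred 'I_6 :=
  connect (fun i j => [&& adjacent i j, i != delta & j != delta]) (alpha 1).

Section Generalities.
Variable k : fieldType.
Local Notation M := 'M[k]_27.

Definition bracket (x y : M) : M := x * y - y * x.

(* exp x for nilpotent x: then x ^+ 27 = 0 and the series stops. *)
Definition expm (x : M) : M := \sum_(m < 27) (m`!%:R)^-1 *: x ^+ m.

Definition is_subspace (W : lmodType k) (U : set W) : Prop :=
  U 0 /\ forall a u v, U u -> U v -> U (a *: u + v).

Definition is_Lie_subalgebra (U : set M) : Prop :=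
  is_subspace U /\ forall x y, U x -> U y -> U (bracket x y).

Definition is_subgroup (H : set M) : Prop :=
  [/\ H 1, forall g h, H g -> H h -> H (g * h)
    & forall g, H g -> g \is a GRing.unit /\ H g^-1].

Definition span (W : lmodType k) (S : set W) : set W :=
  smallest (@is_subspace W) S.
Definition group_generated (S : set M) : set M := smallest is_subgroup S.

Definition act (g : M) (X : set 'cV[k]_27) : set 'cV[k]_27 :=
  [set g *m v | v in X].

End Generalities.

(* V = k^27 is a module over the split Lie algebra of type E_6, on which the
   Chevalley generators act by the matrices e i, f i. *)
Section Representation.
Variables (k : fieldType) (e f : 'I_6 -> 'M[k]_27).
Local Notation M := 'M[k]_27.
Local Notation V := 'cV[k]_27.

Definition coroot (i : 'I_6) : M := bracket (e i) (f i).

(* Serre's presentation of the split simple Lie algebra of type E_6. *)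
Record E6_module : Prop := {
  cartan_comm : forall i j, bracket (coroot i) (coroot j) = 0;
  cartan_e : forall i j,
    bracket (coroot i) (e j) = (cartan i j)%:~R *: e j;
  cartan_f : forall i j,
    bracket (coroot i) (f j) = - (cartan i j)%:~R *: f j;
  comm_ef : forall i j, i != j -> bracket (e i) (f j) = 0;
  serre_e : forall i j, i != j ->
    iter `|1 - cartan i j|%N (bracket (e i)) (e j) = 0;
  serre_f : forall i j, i != j ->
    iter `|1 - cartan i j|%N (bracket (f i)) (f j) = 0
}.

Definition irreducible_module : Prop :=
  forall U : set V, is_subspace U ->
    (forall i v, U v -> U (e i *m v) /\ U (f i *m v)) ->
    U = [set 0] \/ U = setT.

(* v is a highest weight vector, of weight omega_j. *)
Definition highest_weight_vector (j : 'I_6) (v : V) : Prop :=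
  [/\ v != 0, forall i, e i *m v = 0
    & forall i, coroot i *m v = (i == j)%:R *: v].

Definition lie_algebra : set M :=
  smallest (@is_Lie_subalgebra k) (range e `|` range f).

(* rho lists the coordinates of an element of the root lattice in the basis
   of simple roots. *)
Definition root_space (rho : {ffun 'I_6 -> int}) : set M :=
  [set x | lie_algebra x /\ forall i,
     bracket (coroot i) x = (\sum_j rho j * cartan i j)%:~R *: x].

Definition is_root (rho : {ffun 'I_6 -> int}) : Prop :=
  rho != 0 /\ exists x, root_space rho x /\ x != 0.

Definition root_subgroup (rho : {ffun 'I_6 -> int}) : set M :=
  [set expm x | x in root_space rho].

(* The k-points of the split simply connected group of type E_6, which are
   generated by the root subgroups. They act faithfully on V, because the
   weights of V generate the weight lattice; so they are taken to be
   matrices. As k is infinite, G(k) and the k-points of parabolic k-subgroups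
   are Zariski dense, and these subgroups are identified with their groups of
   k-points throughout. *)
Definition G : set M :=
  group_generated (\bigcup_(rho in is_root) root_subgroup rho).

Definition x_pos (i : 'I_6) (t : k) : M := expm (t *: e i).
Definition x_neg (i : 'I_6) (t : k) : M := expm (t *: f i).

(* h_simple i t is the value at t of the cocharacter given by the i-th simple
   coroot. *)
Definition w_simple (i : 'I_6) (t : k) : M :=
  x_pos i t * x_neg i (- t^-1) * x_pos i t.
Definition h_simple (i : 'I_6) (t : k) : M := w_simple i t * (w_simple i 1)^-1.

(* The simple coroots form a basis of the cocharacters, the group being
   simply connected. *)
Definition T : set M :=
  group_generated [set h | exists i t, t != 0 /\ h = h_simple i t].

Definition B : set M :=
  group_generated (T `|` \bigcup_(rho in [set r | is_root r /\
                       forall i, 0 <= r i]) root_subgroup rho).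

Definition parabolic (P : set M) : Prop :=
  [/\ is_subgroup P, P `<=` G
    & exists2 g, G g & [set g * x * g^-1 | x in B] `<=` P].

Definition L (delta : 'I_6) : set M :=
  group_generated (\bigcup_(rho in [set r | is_root r /\
     forall i, r i != 0 -> component delta i]) root_subgroup rho).

Definition Vsub (vplus : V) (delta : 'I_6) : set V :=
  if delta == alpha 1 then [set a *: vplus | a in setT]
  else span [set g *m vplus | g in L delta].

Definition object (vplus : V) : set (set V) :=
  [set X | exists g delta, G g /\ X = act g (Vsub vplus delta)].

Definition stabilizer (X : set V) : set M := [set g | G g /\ act g X = X].

Definition incident (X Y : set V) : Prop :=
  exists2 P, parabolic P & P `<=` stabilizer X `&` stabilizer Y.

Definition geometry_automorphism (vplus : V) (F : set V -> set V) : Prop :=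
  set_bij (object vplus) (object vplus) F /\
  forall X Y, object vplus X -> object vplus Y ->
    (incident (F X) (F Y) <-> incident X Y).

(* F sends the object with stabilizer P to the object with stabilizer
   phi P. *)
Definition induced_by (vplus : V) (phi : M -> M) (F : set V -> set V) : Prop :=
  forall X, object vplus X ->
    object vplus (F X) /\ stabilizer (F X) = phi @` stabilizer X.

(* Only the values of phi on G matter. *)
Record diagram_automorphism (phi : M -> M) : Prop := {
  phi_G : forall g, G g -> G (phi g);
  phi_mul : forall g h, G g -> G h -> phi (g * h) = phi g * phi h;
  phi_invol : forall g, G g -> phi (phi g) = g;
  phi_T : phi @` T = T;
  phi_B : phi @` B = B;
  phi_pos : forall i t, phi (x_pos i t) = x_pos (sigma i) t;
  phi_neg : forall i t, phi (x_neg i t) = x_neg (sigma i) t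
}.

Record phi_invariant_bilinear (phi : M -> M) (b : V -> V -> k) : Prop := {
  bilinear_l : forall y, scalar (fun x => b x y);
  bilinear_r : forall x, scalar (b x);
  bilinear_neq0 : exists x y, b x y != 0;
  bilinear_inv : forall g x y, G g -> b (phi g *m x) (g *m y) = b x y
}.

(* N is a cubic form with polarization N3; in characteristic 0 every cubic
   form is of this kind for a unique N3. *)
Record invariant_cubic (N : V -> k) (N3 : V -> V -> V -> k) : Prop := {
  cubic_linear : forall x y, scalar (N3 x y);
  cubic_sym12 : forall x y z, N3 x y z = N3 y x z;
  cubic_sym23 : forall x y z, N3 x y z = N3 x z y;
  cubic_polar : forall x, N3 x x x = 6%:R * N x;
  cubic_neq0 : exists x, N x != 0;
  cubic_inv : forall g x, G g -> N (g *m x) = N x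
}.

End Representation.

Section Brace.
Variables (k : fieldType) (b : 'cV[k]_27 -> 'cV[k]_27 -> k).
Variable sharp : 'cV[k]_27 -> 'cV[k]_27 -> 'cV[k]_27.

Definition adjoint (x : 'cV[k]_27) : 'cV[k]_27 := 2%:R^-1 *: sharp x x.

Definition brace (x y z : 'cV[k]_27) : 'cV[k]_27 :=
  b x y *: z + b z y *: x - sharp (sharp x z) y.

Definition psi (X : set 'cV[k]_27) : set 'cV[k]_27 :=
  [set y | forall x z, X x -> X (brace x y z)].

End Brace.

(* Main.v *)
Require Import Defs.
From mathcomp Require Import all_boot all_order all_fingroup all_algebra.
From mathcomp Require Import boolp classical_sets functions.
From mathcomp Require Import zify ring.

(* V is minuscule: it has a basis of 27 weight vectors, permuted up to zeroes by
   the e i and f i. In this basis invariance determines b, the trilinear form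
   and hence # up to one scalar each, and the adjoint identity leaves only one
   free scalar, by which the brace product is a multiple of an explicit integral
   product. Each V_delta is spanned by the weight vectors whose weight differs
   from omega_1 by simple roots in the component of alpha_1, so
   psi V_delta = V_(sigma delta) is a finite verification.
   The rest is formal: polarizing N and using b gives
   {g x, phi g y, g z} = g {x, y, z}, hence psi (g X) = (phi g) (psi X), so psi is
   an involution of the geometry that carries stabilizers, and parabolic
   subgroups contained in them, to their images under phi. *)

Set Implicit Arguments.
Unset Strict Implicit.
Unset Printing Implicit Defensive.

Import GRing.Theory.
Local Open Scope classical_set_scope.
Local Open Scope ring_scope.

(** * The 27 weights *)

(** The module is known only through the Serre relations, so the action on weight vectors has to be
    derived: sl2 arguments give the vanishing of [f i], and tables on natural numbers, which
    [vm_compute] can evaluate, give the combinatorics. Irreducibility makes the 27 vectors span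
    k^27, hence a basis. A general root enters only as a nonzero element of the root lattice:
    weights have coordinates -1, 0, 1, so a root vector has cube zero, which is enough to control
    its exponential. As for the scalars, put c = b (v 0) (v 26) and n = N3 (v 0) (v 12) (v 26). Then
    # is n/c times an integral product, and x = v 0 + v 12 + v 26 satisfies x^# = (n/c) x, so the
    adjoint identity at x forces (n/c)^2 = c. Both kinds of terms of the brace thus carry the same
    factor c, which is nonzero and does not affect psi. The inclusion of psi V_delta in V_(sigma
    delta) is a finite check because weights separate basis vectors: every coordinate of y that must
    vanish is seen, alone, in one coordinate of one brace {v a, y, v s}. *)

Definition cartan_nat (i j : nat) : int :=
  if i == j then 2 else
  if ((i.+1, j.+1) \in E6_edges) || ((j.+1, i.+1) \in E6_edges) then -1 else 0.

(* One word for each weight: the 0-based indices of the lowering operators leading to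
   it from the highest weight, the operator applied last coming first. *)
Definition words : seq (seq nat) :=
 [:: [:: ]; [:: 0]; [:: 2; 0]; [:: 3; 2; 0]; [:: 1; 3; 2; 0]; [:: 4; 3; 2; 0];
  [:: 4; 1; 3; 2; 0]; [:: 5; 4; 3; 2; 0]; [:: 3; 4; 1; 3; 2; 0];
  [:: 5; 4; 1; 3; 2; 0]; [:: 2; 3; 4; 1; 3; 2; 0]; [:: 5; 3; 4; 1; 3; 2; 0];
  [:: 0; 2; 3; 4; 1; 3; 2; 0]; [:: 5; 2; 3; 4; 1; 3; 2; 0];
  [:: 4; 5; 3; 4; 1; 3; 2; 0]; [:: 5; 0; 2; 3; 4; 1; 3; 2; 0];
  [:: 4; 5; 2; 3; 4; 1; 3; 2; 0]; [:: 4; 5; 0; 2; 3; 4; 1; 3; 2; 0];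
  [:: 3; 4; 5; 2; 3; 4; 1; 3; 2; 0]; [:: 3; 4; 5; 0; 2; 3; 4; 1; 3; 2; 0];
  [:: 1; 3; 4; 5; 2; 3; 4; 1; 3; 2; 0];
  [:: 1; 3; 4; 5; 0; 2; 3; 4; 1; 3; 2; 0];
  [:: 2; 3; 4; 5; 0; 2; 3; 4; 1; 3; 2; 0];
  [:: 2; 1; 3; 4; 5; 0; 2; 3; 4; 1; 3; 2; 0];
  [:: 3; 2; 1; 3; 4; 5; 0; 2; 3; 4; 1; 3; 2; 0];
  [:: 4; 3; 2; 1; 3; 4; 5; 0; 2; 3; 4; 1; 3; 2; 0];
  [:: 5; 4; 3; 2; 1; 3; 4; 5; 0; 2; 3; 4; 1; 3; 2; 0]]%N.

Definition word (n : nat) : seq nat := nth [::] words n.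

Definition weights : seq (seq int) := Eval vm_compute in
  [seq [seq foldr (fun j s => s - cartan_nat i j) (i == 0%N)%:R (word n)
       | i <- iota 0 6] | n <- iota 0 27].

Definition wt (n i : nat) : int := nth 0 (nth [::] weights n) i.

Definition up_table : seq (seq nat) := Eval vm_compute in
  [seq [seq index [seq wt n j + cartan_nat j i | j <- iota 0 6] weights
       | i <- iota 0 6] | n <- iota 0 27].
Definition dn_table : seq (seq nat) := Eval vm_compute in
  [seq [seq index [seq wt n j - cartan_nat j i | j <- iota 0 6] weights
       | i <- iota 0 6] | n <- iota 0 27].

(* [up n i] and [dn n i] number the weights obtained by adding and subtracting
   the i-th simple root to the n-th one; they are 27 if there is none. *)
Definition up (n i : nat) : nat := nth 27 (nth [::] up_table n) i.
Definition dn (n i : nat) : nat := nth 27 (nth [::] dn_table n) i.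

(* The facts about weights behind the induction in [weight_vectorP]: when the last
   lowering operator of v n is exchanged with another e i or f i, the square of
   weights concerned commutes. *)
Definition step_check (n : nat) : bool :=
  let i0 := head 0%N (word n) in let p := index (behead (word n)) words in
  [&& (i0 < 6)%N, (p < n)%N, word n == i0 :: word p, wt p i0 == 1, up n i0 == p
    & all (fun i => (wt n i == wt p i - cartan_nat i i0) && ((i != i0) ==>
      [&& (wt n i == -1) ==> [&& wt p i == -1, cartan_nat i0 i == 0,
            (up n i < n)%N, wt (up n i) i0 == -1 & up (up n i) i0 == up p i]
        & if wt p i == -1 then let q := up p i in (q < p)%N &&
            (if wt q i0 == 1 then [&& wt n i == -1, (up n i < n)%N,
               wt (up n i) i0 == -1 & up (up n i) i0 == q] else wt n i != -1)
          else wt n i != -1])) (iota 0 6)].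

(** The weights are minuscule. Raising strictly lowers the number, which lets an induction on [n]
    use what is known for [up n i]. *)
Definition weight_check (n : nat) : bool :=
  all (fun i => [&& wt n i \in [:: -1; 0; 1],
    (wt n i == 1) ==>
      [&& (dn n i < 27)%N, wt (dn n i) i == -1 & up (dn n i) i == n]
    & (wt n i == -1) ==>
      [&& (up n i < 27)%N, wt (up n i) i == 1, up n i < n & dn (up n i) i == n]%N])
   (iota 0 6).

Lemma step_checkP n : (0 < n < 27)%N -> step_check n.
Proof.
have H : all step_check (iota 1 26) by vm_compute.
by move=> Hn; apply: (allP H); rewrite mem_iota.
Qed.

Lemma weight_checkP n (i : 'I_6) : (n < 27)%N ->
  [&& wt n i \in [:: -1; 0; 1],
    (wt n i == 1) ==>
      [&& (dn n i < 27)%N, wt (dn n i) i == -1 & up (dn n i) i == n]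
    & (wt n i == -1) ==>
      [&& (up n i < 27)%N, wt (up n i) i == 1, up n i < n & dn (up n i) i == n]%N].
Proof.
have H : all weight_check (iota 0 27) by vm_compute.
move=> Hn; have /(allP H) : n \in iota 0 27 by rewrite mem_iota.
by move=> /allP /(_ (nat_of_ord i)); apply; rewrite mem_iota /=.
Qed.

(** * Finite-dimensional sl2 arguments *)

Section Sl2.
Variables (k : fieldType) (char0 : [pchar k] =i pred0).
Local Notation M := 'M[k]_27.
Local Notation V := 'cV[k]_27.

Lemma mulmx_act (x y : M) (u : V) : (x * y) *m u = x *m (y *m u).
Proof. by rewrite mulmxA. Qed.

Lemma bracket_act (x y : M) (u : V) :
  bracket x y *m u = x *m (y *m u) - y *m (x *m u).
Proof. by rewrite /bracket mulmxBl !mulmx_act. Qed.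

Lemma bracket_actC (x y : M) (u : V) :
  x *m (y *m u) = bracket x y *m u + y *m (x *m u).
Proof. by rewrite bracket_act subrK. Qed.

Lemma char0_natr_inj (m n : nat) : m%:R = n%:R :> k -> m = n.
Proof.
have H p : p%:R = 0 :> k -> p = 0%N.
  by move/eqP; rewrite (proj1 (pcharf0P k) char0) => /eqP.
wlog le : m n / (m <= n)%N.
  by move=> W E; case/orP: (leq_total m n) => /W; [|move=> /(_ (esym E)) ->]; auto.
move=> E; have /H : (n - m)%:R = 0 :> k by rewrite natrB // E subrr.
lia.
Qed.

Lemma char0_intr_inj (m n : int) : m%:~R = n%:~R :> k -> m = n.
Proof.
have H p : p%:~R = 0 :> k -> p = 0.
  case: p => p; first by move=> E; have -> : p = 0%N by apply: char0_natr_inj.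
  rewrite NegzE mulrNz => /eqP; rewrite oppr_eq0 => /eqP E.
  by have := @char0_natr_inj p.+1 0 E.
move=> E; have /H : (m - n)%:~R = 0 :> k by rewrite rmorphB /= E subrr.
lia.
Qed.

(** Otherwise the characteristic polynomial, of degree 27, would have the 28 distinct roots [c 0],
    ..., [c 27]. The transpose is there because [eigenvalue] refers to row vectors. *)
Lemma eigenvalues_bounded (h : M) (c : nat -> k) (u : nat -> V) :
  injective c -> (forall j, h *m u j = c j *: u j) ->
  exists j, u j = 0.
Proof.
move=> cI hu; apply: contrapT => /forallNP nz.
have := @max_poly_roots _ (char_poly h^T) [seq c j | j <- iota 0 28].
rewrite size_char_poly size_map size_iota ltnn.
move=> /(_ (monic_neq0 (char_poly_monic _))); rewrite map_inj_uniq // iota_uniq.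
suff -> : all (root (char_poly h^T)) [seq c j | j <- iota 0 28] by move/(_ isT isT).
apply/allP => _ /mapP[j _ ->]; rewrite -eigenvalue_root_char.
apply/eigenvalueP; exists (u j)^T; first by rewrite -trmx_mul hu linearZ.
by apply: contra_notN (nz j) => /eqP E; rewrite -[u j]trmxK E trmx0.
Qed.

(* Otherwise the vectors y^j u would give infinitely many eigenvalues of the
   coroot. *)
Lemma sl2_negative_weight (x y : M) (u : V) (a : nat) :
  bracket (bracket x y) y = - 2%:R *: y -> x *m u = 0 ->
  bracket x y *m u = - a.+1%:R *: u -> u = 0.
Proof.
set h := bracket x y => hy xu hu.
pose w j := iter j (mulmx y) u.
have hw j : h *m w j = - (a.+1 + 2 * j)%:R *: w j.
  elim: j => [|j IH]; first by rewrite muln0 addn0.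
  rewrite /w iterS -/(w j) bracket_actC hy IH -scalemxAl -scalemxAr -scalerDl.
  by rewrite -opprD -natrD; congr (- _%:R *: _); lia.
have xw j : x *m w j.+1 = - (j.+1 * (a.+1 + j))%:R *: w j.
  elim: j => [|j IH].
    by rewrite /w /= bracket_actC xu mulmx0 addr0 -/h hu mul1n addn0.
  rewrite {1}/w iterS -/(w _) bracket_actC -/h hw IH -scalemxAr.
  rewrite -[y *m w j]/(w j.+1) -scalerDl -opprD -natrD.
  by congr (- _%:R *: _); lia.
have [j wj0] : exists j, w j = 0.
  apply: (@eigenvalues_bounded h (fun j => - (a.+1 + 2 * j)%:R) w) => // i j.
  by move/oppr_inj/char0_natr_inj; lia.
(* By [xw], applying [x] to y^(j+1) u gives a nonzero multiple of y^j u, so vanishing descends from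
   y^(j+1) u to y^j u and finally to u. *)
elim: j wj0 => [//|j IH] w0; apply: IH.
move: (xw j); rewrite w0 mulmx0 => /esym/eqP; rewrite scaler_eq0 oppr_eq0.
case/orP => /eqP // E; have : (j.+1 * (a.+1 + j))%:R = 0%:R :> k by [].
by move/char0_natr_inj; lia.
Qed.

(** Here [y *m u] has weight -2 and is killed by [x], because xyu = hu + yxu = 0. *)
Lemma sl2_weight0 (x y : M) (u : V) :
  bracket (bracket x y) y = - 2%:R *: y -> x *m u = 0 ->
  bracket x y *m u = 0 -> y *m u = 0.
Proof.
move=> hy xu hu; apply: (@sl2_negative_weight x y _ 1) => //.
  by rewrite bracket_actC hu xu mulmx0 addr0.
by rewrite bracket_actC hy hu mulmx0 addr0 scalemxAl.
Qed.

(** Here y^2 u has weight -3 and is killed by [x]: the contributions -yu of h(yu) and yu of y(hu)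
    cancel. *)
Lemma sl2_weight1 (x y : M) (u : V) :
  bracket (bracket x y) y = - 2%:R *: y -> x *m u = 0 ->
  bracket x y *m u = u -> y *m (y *m u) = 0.
Proof.
move=> hy xu hu.
have hyu : bracket x y *m (y *m u) = - (y *m u).
  rewrite bracket_actC hy hu -scalemxAl -[X in _ + X]scale1r -scalerDl -scaleN1r.
  by congr (_ *: _); ring.
apply: (@sl2_negative_weight x y _ 2) => //.
  rewrite bracket_actC hyu [x *m (y *m u)]bracket_actC hu xu mulmx0 addr0.
  by rewrite addNr.
rewrite bracket_actC hy hyu -scalemxAl mulmxN -scaleN1r -scalerDl.
by congr (_ *: _); ring.
Qed.

End Sl2.

(** * The weight basis *)

Section WeightBasis.
Variables (k : fieldType) (char0 : [pchar k] =i pred0).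
Variables (e f : 'I_6 -> 'M[k]_27) (HV : E6_module e f).
Variable vplus : 'cV[k]_27.
Hypothesis Hvplus : highest_weight_vector e f (alpha 1) vplus.

Definition weight_vector (n : nat) : 'cV[k]_27 :=
  foldr (fun j u => f (inord j) *m u) vplus (word n).
Local Notation v := weight_vector.

Lemma cartanE (i j : 'I_6) : cartan i j = cartan_nat i j.
Proof. by []. Qed.

Lemma cartan_f_act (i j : 'I_6) (u : 'cV[k]_27) :
  coroot e f i *m (f j *m u) =
  f j *m (coroot e f i *m u) - (cartan_nat i j)%:~R *: (f j *m u).
Proof.
by rewrite bracket_actC (cartan_f HV) cartanE -scalemxAl scaleNr addrC.
Qed.

Lemma comm_ef_act (i j : 'I_6) (u : 'cV[k]_27) : i != j ->
  e i *m (f j *m u) = f j *m (e i *m u).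
Proof. by move=> ij; rewrite bracket_actC (comm_ef HV) // mul0mx add0r. Qed.

Lemma comm_f_act (i j : 'I_6) (u : 'cV[k]_27) :
  cartan_nat i j = 0 -> f i *m (f j *m u) = f j *m (f i *m u).
Proof.
move=> c0; have ij : i != j by apply: contra_eq_neq c0 => ->; rewrite /cartan_nat eqxx.
rewrite bracket_actC; have := serre_f HV ij; rewrite cartanE c0 /= => ->.
by rewrite mul0mx add0r.
Qed.

Lemma coroot_f (i : 'I_6) : bracket (bracket (e i) (f i)) (f i) = - 2%:R *: f i.
Proof. by rewrite -/(coroot e f i) (cartan_f HV) /cartan eqxx. Qed.

(** The action of [f i] is stated backwards, from [up n i] to [n], so that only vectors of number at
    most [n] occur and induction applies. The forward form is [f_weight_vector]. *)
Definition weight_vector_spec (n : nat) : Prop :=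
  [/\ forall i, coroot e f i *m v n = (wt n i)%:~R *: v n,
      forall i, e i *m v n = if wt n i == -1 then v (up n i) else 0,
      forall i : 'I_6, wt n i = -1 -> v n = f i *m v (up n i)
    & forall i : 'I_6, wt n i != 1 -> f i *m v n = 0].

(** In weight 0 the vector is killed by [e i], hence by [f i]. In weight -1 it is [f i] applied to a
    vector of weight 1 killed by [e i], and a second [f i] gives 0. *)
Lemma f_weight_le0 n : (n < 27)%N ->
  (forall i, coroot e f i *m v n = (wt n i)%:~R *: v n) ->
  (forall i, e i *m v n = if wt n i == -1 then v (up n i) else 0) ->
  (forall i : 'I_6, wt n i = -1 -> v n = f i *m v (up n i)) ->
  (forall i : 'I_6, wt n i = -1 -> weight_vector_spec (up n i)) ->
  forall i : 'I_6, wt n i != 1 -> f i *m v n = 0.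
Proof.
move=> n27 hn en fn IH i wn.
have /and3P[] := weight_checkP i n27; rewrite !inE (negPf wn) orbF.
case/orP => /eqP w _; rewrite w /= => W.
  move/and4P: W => [n' /eqP w' _ _].
  have [h' e' _ _] := IH _ w.
  rewrite (fn _ w); apply: (sl2_weight1 char0 (coroot_f i)); first by rewrite e' w'.
  by rewrite -/(coroot e f i) h' w' scale1r.
apply: (sl2_weight0 char0 (coroot_f i)); first by rewrite en w.
by rewrite -/(coroot e f i) hn w scale0r.
Qed.

Lemma weight_vectorP n : (n < 27)%N -> weight_vector_spec n.
Proof.
elim/ltn_ind: n => -[|n0] IH n27.
  have [_ ep hp] := Hvplus.
  have w0 (i : 'I_6) : wt 0 i = (i == 0%N :> nat)%:R.
    by case: i => [[|[|[|[|[|[|//]]]]]] i6].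
  have h0 (i : 'I_6) : coroot e f i *m v 0 = (wt 0 i)%:~R *: v 0.
    rewrite hp w0; congr (_ *: _).
    by rewrite -val_eqE /= inordK //; case: eqP.
  have e0 (i : 'I_6) : e i *m v 0 = if wt 0 i == -1 then v (up 0 i) else 0.
    by rewrite w0 ep; case: (nat_of_ord i).
  have f0 (i : 'I_6) : wt 0 i = -1 -> v 0 = f i *m v (up 0 i).
    by rewrite w0; case: (nat_of_ord i).
  by split => //; apply: f_weight_le0 => // i; rewrite w0; case: (nat_of_ord i).
have /step_checkP : (0 < n0.+1 < 27)%N by [].
set n := n0.+1 in IH n27 *; rewrite /step_check.
set i0 := head 0%N (word n); set p := index _ words.
case/and5P => i06 pn /eqP wordn /eqP wp0 /andP[/eqP upn0 /allP chk].
pose j0 : 'I_6 := inord i0.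
have j0E : j0 = i0 :> nat by rewrite inordK.
have vn : v n = f j0 *m v p by rewrite /v wordn.
have wn i : (i < 6)%N -> wt n i = wt p i - cartan_nat i i0.
  by move=> i6; have /andP[/eqP] := chk i ltac:(by rewrite mem_iota).
have [hp ep fp f'p] := IH _ pn (ltn_trans pn n27).
have {}chk (i : 'I_6) : i != j0 -> _ := fun ne =>
  implyP (proj2 (andP (chk i (ltac:(by rewrite mem_iota /= ltn_ord)))))
  (ltac:(by rewrite -j0E (inj_eq val_inj))).
have hn i : coroot e f i *m v n = (wt n i)%:~R *: v n.
  by rewrite vn cartan_f_act hp -scalemxAr -scalerBl wn // -j0E rmorphB.
have en i : e i *m v n = if wt n i == -1 then v (up n i) else 0.
  have [->|ne] := eqVneq i j0.
    (* As v p has weight 1 for j0, it is killed by [e j0] and fixed by the coroot. *)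
    rewrite vn bracket_actC -/(coroot e f j0) hp ep j0E wp0 mulmx0 addr0 scale1r.
    by rewrite wn // wp0 /cartan_nat eqxx upn0.
  (* For i different from j0, [e i] passes [f j0], and what remains is [f j0] on v (up p i), already
     known by induction. *)
  rewrite vn comm_ef_act // ep.
  have /andP[_] := chk _ ne.
  case: ifP => [_ /andP[qp]|_ /negPf ->]; last by rewrite mulmx0.
  set q := up p i in qp *.
  have qn := ltn_trans qp pn.
  have [_ _ _ f'q] := IH _ qn (ltn_trans qn n27).
  case: ifP => [_ /and4P[-> mn /eqP wm /eqP um]|/negbT wq /negPf ->]; last first.
    by rewrite f'q ?j0E.
  have [_ _ fm _] := IH _ mn (ltn_trans mn n27).
  by rewrite [RHS](fm j0) j0E // um.
have fn (i : 'I_6) : wt n i = -1 -> v n = f i *m v (up n i).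
  have [-> _|ne wni] := eqVneq i j0; first by rewrite vn j0E upn0.
  have /andP[/implyP/(_ (introT eqP wni))] := chk _ ne.
  case/and5P=> /eqP wpi /eqP c0 mn /eqP wm /eqP um _.
  have [_ _ fm _] := IH _ mn (ltn_trans mn n27).
  (* The nodes i and j0 are not joined, so the two lowering operators commute and both paths start
     from [up p i]. *)
  rewrite vn (fp _ wpi) comm_f_act ?j0E //; congr (_ *m _).
  by rewrite [RHS](fm j0) j0E // um.
split => //; apply: f_weight_le0 => // i wi.
have /and3P[_ _] := weight_checkP i n27; rewrite wi /= => /and4P[n' _ ltn _].
exact: IH.
Qed.

Lemma coroot_weight_vector n i : (n < 27)%N ->
  coroot e f i *m v n = (wt n i)%:~R *: v n.
Proof. by case/weight_vectorP. Qed.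

Lemma e_weight_vector n i : (n < 27)%N ->
  e i *m v n = if wt n i == -1 then v (up n i) else 0.
Proof. by case/weight_vectorP. Qed.

Lemma f_weight_vector n (i : 'I_6) : (n < 27)%N ->
  f i *m v n = if wt n i == 1 then v (dn n i) else 0.
Proof.
move=> n27; have [_ _ _ f'] := weight_vectorP n27.
case: ifPn => [w|/f' //].
have /and3P[_ /implyP/(_ w)/and3P[m27 /eqP wm /eqP um] _] := weight_checkP i n27.
by have [_ _ /(_ _ wm) + _] := weight_vectorP m27; rewrite um.
Qed.

End WeightBasis.

(** The coefficient of the j-th simple root in omega_1 minus the n-th weight. *)
Definition mult (n j : nat) : int := (count_mem j (word n))%:Z.

Lemma wt_mult n (i : 'I_6) : (n < 27)%N ->
  wt n i = (i == 0%N :> nat)%:R - \sum_(j < 6) mult n j * cartan i j.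
Proof.
have : all (fun n => all (fun i => wt n i == (i == 0%N)%:R -
    foldr (fun j s => mult n j * cartan_nat i j + s) 0 (iota 0 6)) (iota 0 6))
  (iota 0 27) by vm_compute.
move=> /allP H n27; have /allP/(_ (nat_of_ord i)) := H n ltac:(by rewrite mem_iota).
rewrite mem_iota ltn_ord => /(_ isT)/eqP ->.
by rewrite !big_ord_recl big_ord0.
Qed.

Lemma wt_inj m n : (m < 27)%N -> (n < 27)%N ->
  (forall i : 'I_6, wt m i = wt n i) -> m = n.
Proof.
have : all (fun m => all (fun n => (all (fun i => wt m i == wt n i) (iota 0 6)) ==>
  (m == n)) (iota 0 27)) (iota 0 27) by vm_compute.
move=> /allP H m27 n27 E.
have /allP/(_ n) := H m ltac:(by rewrite mem_iota).
rewrite mem_iota => /(_ n27)/implyP H'; apply/eqP/H'/allP => i; rewrite mem_iota => i6.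
by have /= -> := E (Ordinal i6).
Qed.

(** The Cartan matrix of E_6 has determinant 3. Its entries are replaced by their values to leave a
    numerical linear system for [lia]. *)
Lemma cartan_inj (r : 'I_6 -> int) :
  (forall i, \sum_j r j * cartan i j = 0) -> forall j, r j = 0.
Proof.
move=> H; pose o j : 'I_6 := inord j.
have E (i : nat) : (i < 6)%N ->
    foldr (fun j s => r (o j) * cartan_nat i j + s) 0 (iota 0 6) = 0.
  move=> i6; transitivity (\sum_(j < 6) r (o j) * cartan_nat i j).
    by rewrite !big_ord_recl big_ord0.
  rewrite -[RHS](H (Ordinal i6)).
  by apply: eq_bigr => j _; rewrite /o inord_val.
move: (E 0%N isT) (E 1%N isT) (E 2%N isT) (E 3%N isT) (E 4%N isT) (E 5%N isT).
rewrite /= ?addr0.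
repeat match goal with |- context [cartan_nat ?a ?b] =>
  let c := eval vm_compute in (cartan_nat a b) in change (cartan_nat a b) with c end.
move=> E0 E1 E2 E3 E4 E5 j; rewrite -[j]inord_val -/(o j).
by case: j => [[|[|[|[|[|[|//]]]]]] _] /=; lia.
Qed.

Lemma abs_weight_le1 n (i : 'I_6) : (n < 27)%N -> (`|wt n i| <= 1)%N.
Proof. by move/(weight_checkP i)/and3P => [+ _ _]; rewrite !inE => /or3P[]/eqP->. Qed.

(** * Coordinates in the weight basis *)

Section Coordinates.
Variables (k : fieldType) (char0 : [pchar k] =i pred0).
Variables (e f : 'I_6 -> 'M[k]_27) (HV : E6_module e f).
Hypothesis irrV : irreducible_module e f.
Variable vplus : 'cV[k]_27.
Hypothesis Hvplus : highest_weight_vector e f (alpha 1) vplus.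
Local Notation v := (weight_vector f vplus).
Local Notation V := 'cV[k]_27.

Definition weight_basis : 'M[k]_27 := \matrix_(i, n) v n i 0.
Definition wcoord (n : 'I_27) (x : V) : k := (invmx weight_basis *m x) n 0.

Lemma weight_basisE (c : V) : weight_basis *m c = \sum_n c n 0 *: v n.
Proof.
apply/colP => i; rewrite mxE summxE; apply: eq_bigr => n _.
by rewrite !mxE mulrC.
Qed.

Lemma weight_basis_col (n : 'I_27) : weight_basis *m delta_mx n 0 = v n.
Proof. by rewrite -colE; apply/colP => i; rewrite !mxE. Qed.

(** The span of the weight vectors is stable under all [e i] and [f i] and contains [vplus], so it
    is everything by irreducibility; 27 vectors spanning k^27 form an invertible matrix. *)
Lemma weight_basis_unit : weight_basis \in unitmx.
Proof.
pose U : set V := [set x | exists c, x = weight_basis *m c].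
have Usub : is_subspace U.
  split; first by exists 0; rewrite mulmx0.
  by move=> a _ _ [x ->] [y ->]; exists (a *: x + y); rewrite mulmxDr -scalemxAr.
have U0 := proj1 Usub; have UZD := proj2 Usub.
have Uv n : (n < 27)%N -> U (v n).
  by move=> n27; exists (delta_mx (Ordinal n27) 0); rewrite weight_basis_col.
have Ustab (x : 'M[k]_27) : (forall n, (n < 27)%N -> U (x *m v n)) ->
    forall u, U u -> U (x *m u).
  move=> xv _ [c ->]; rewrite weight_basisE mulmx_sumr.
  elim/big_ind: _ => // [a b Ua Ub|n _].
    by rewrite -[a]scale1r; apply: UZD.
  by rewrite -scalemxAr -[X in U X]addr0; apply: UZD => //; apply: xv.
have [] // := irrV Usub.
- move=> i u Uu; split; apply: Ustab Uu => n n27.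
    rewrite (e_weight_vector char0 HV Hvplus) //; case: ifP => // w.
    by have /and3P[_ _ /implyP/(_ w)/and4P[m27 _ _ _]] := weight_checkP i n27; apply: Uv.
  rewrite (f_weight_vector char0 HV Hvplus) //; case: ifP => // w.
  by have /and3P[_ /implyP/(_ w)/and3P[m27 _ _] _] := weight_checkP i n27; apply: Uv.
- move=> UE; have [/eqP] := Hvplus; case; have : U vplus by apply: (Uv 0%N).
  by rewrite UE.
move=> UT; have UT' x : U x by rewrite UT.
have /choice[c cE] (j : 'I_27) : exists c, delta_mx j 0 = weight_basis *m c := UT' _.
suff /mulmx1_unit[] : weight_basis *m (\matrix_(i, j) c j i 0) = 1%:M by [].
apply/matrixP => i j; have /colP/(_ i) := cE j.
rewrite !mxE eqxx andbT => ->; apply: eq_bigr => n _; by rewrite !mxE.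
Qed.

Lemma wcoord_scalar n : scalar (wcoord n).
Proof. by move=> a x y; rewrite /wcoord mulmxDr -scalemxAr !mxE. Qed.

Lemma wcoord_weight_vector (m n : 'I_27) : wcoord m (v n) = (m == n)%:R.
Proof.
by rewrite /wcoord -weight_basis_col mulKmx ?weight_basis_unit // mxE eqxx andbT.
Qed.

Lemma wcoord_decomposition (x : V) : x = \sum_n wcoord n x *: v n.
Proof. by rewrite -weight_basisE; apply/esym; apply: mulKVmx weight_basis_unit _. Qed.

Lemma wcoord_inj (x y : V) : (forall n, wcoord n x = wcoord n y) -> x = y.
Proof.
move=> E; rewrite [x]wcoord_decomposition [y]wcoord_decomposition.
by apply: eq_bigr => n _; rewrite E.
Qed.

End Coordinates.

(** * Root subgroups and the subspaces V_delta *)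

Section Exponential.
Variables (k : fieldType) (char0 : [pchar k] =i pred0).
Local Notation M := 'M[k]_27.

Lemma expm_sum (x : M) r : (r <= 27)%N -> x ^+ r = 0 ->
  expm x = \sum_(m < r) (m`!%:R)^-1 *: x ^+ m.
Proof.
move=> r27 xr; rewrite /expm -!(big_mkord xpredT (fun m => (m`!%:R)^-1 *: x ^+ m)).
rewrite (big_cat_nat (n := r)) //= [X in _ + X]big_nat_cond [X in _ + X]big1 ?addr0 //.
move=> i /andP[/andP[ri _] _].
by rewrite -(subnKC ri) exprD xr mul0r scaler0.
Qed.

Lemma expm_cube0 (x : M) : x ^+ 3 = 0 -> expm x = 1 + x + 2%:R^-1 *: x ^+ 2.
Proof.
move=> x3; rewrite (@expm_sum x 3) // !big_ord_recl big_ord0 /=.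
by rewrite !invr1 !scale1r addr0 addrA.
Qed.

Lemma expm_sqr0 (x : M) : x ^+ 2 = 0 -> expm x = 1 + x.
Proof.
move=> x2; rewrite (@expm_sum x 2) // !big_ord_recl big_ord0 /=.
by rewrite !invr1 !scale1r addr0.
Qed.

Lemma two_neq0 : 2%:R != 0 :> k.
Proof. by apply/eqP => E; have := @char0_natr_inj k char0 2 0 E. Qed.

(** With a = 1 + x^2/2, which commutes with x, the product is a^2 - x^2, and a^2 = 1 + x^2 since x^4
    = 0. *)
Lemma expm_cube0_mulN (x : M) : x ^+ 3 = 0 -> expm x * expm (- x) = 1.
Proof.
move=> x3; have x4 : x ^+ 4 = 0 by rewrite exprS x3 mulr0.
have Nx3 : (- x) ^+ 3 = 0 by rewrite exprNn x3 mulr0.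
rewrite !expm_cube0 // sqrrN; set h := 2%:R^-1.
have [a Ea] : exists a, a = 1 + h *: x ^+ 2 by exists (1 + h *: x ^+ 2).
have ax : x * a = a * x.
  by rewrite Ea mulrDr mulrDl mulr1 mul1r -scalerAr -scalerAl -exprS -exprSr.
have -> : 1 + x + h *: x ^+ 2 = a + x by rewrite Ea addrAC.
have -> : 1 - x + h *: x ^+ 2 = a - x by rewrite Ea addrAC.
rewrite mulrBr !mulrDl ax opprD addrA addrK -[x * x]expr2.
have x2a : x ^+ 2 * a = x ^+ 2.
  by rewrite Ea mulrDr mulr1 -scalerAr -exprD x4 scaler0 addr0.
rewrite {1}Ea mulrDl mul1r -scalerAl x2a Ea -[1 + _ + _]addrA -scalerDl.
rewrite -mulr2n -[h *+ 2]mulr_natl mulfV ?two_neq0 // scale1r.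
by rewrite addrK.
Qed.

Lemma is_subgroup_units : is_subgroup [set g : M | g \is a GRing.unit].
Proof.
split=> [|g h|g] /=; rewrite ?unitr1 //.
  by move=> gu hu; rewrite unitrMl.
by rewrite unitrV.
Qed.

(** Were some generator not invertible, no subgroup would contain [S] and the intersection over an
    empty family would be all of M. *)
Lemma is_subgroup_generated (S : set M) :
  S `<=` [set g | g \is a GRing.unit] -> is_subgroup (group_generated S).
Proof.
move=> Su; split=> [A [[]] //|g h Sg Sh A HA|g Sg].
  by have [[_ AM _] _] := HA; exact: AM (Sg A HA) (Sh A HA).
split; first exact: (Sg _ (conj is_subgroup_units Su)).
move=> A HA; have [[_ _ AV] _] := HA.
by have [] := AV g (Sg A HA).
Qed.

Lemma sub_group_generated (S : set M) : S `<=` group_generated S.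
Proof. by move=> g Sg A [_]; apply. Qed.

Lemma group_generated_min (S H : set M) :
  is_subgroup H -> S `<=` H -> group_generated S `<=` H.
Proof. by move=> Hs SH g /(_ H (conj Hs SH)). Qed.

Lemma subset_span (W : lmodType k) (S : set W) : S `<=` Defs.span S.
Proof. by move=> g Sg A [_]; apply. Qed.

Lemma span_minimal (W : lmodType k) (S H : set W) :
  is_subspace H -> S `<=` H -> Defs.span S `<=` H.
Proof. by move=> Hs SH g /(_ H (conj Hs SH)). Qed.

Lemma is_subspace_span (W : lmodType k) (S : set W) : is_subspace (Defs.span S).
Proof.
split=> [A [[]] //|a u w Su Sw A HA].
by have [[_ AZD] _] := HA; exact: AZD (Su A HA) (Sw A HA).
Qed.

Lemma lie_algebra_e (e f : 'I_6 -> M) i t : lie_algebra e f (t *: e i).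
Proof.
move=> A [[[A0 AZD] _] gA]; rewrite -[X in A X]addr0; apply: AZD => //.
by apply: gA; left; exists i.
Qed.

Lemma lie_algebra_f (e f : 'I_6 -> M) i t : lie_algebra e f (t *: f i).
Proof.
move=> A [[[A0 AZD] _] gA]; rewrite -[X in A X]addr0; apply: AZD => //.
by apply: gA; right; exists i.
Qed.

End Exponential.

(** * Root vectors shift weights *)

Section RootSpaces.
Variables (k : fieldType) (char0 : [pchar k] =i pred0).
Variables (e f : 'I_6 -> 'M[k]_27) (HV : E6_module e f).
Hypothesis irrV : irreducible_module e f.
Variable vplus : 'cV[k]_27.
Hypothesis Hvplus : highest_weight_vector e f (alpha 1) vplus.
Local Notation v := (weight_vector f vplus).
Local Notation V := 'cV[k]_27.
Local Notation M := 'M[k]_27.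
Local Notation crd := (wcoord f vplus).
Local Notation h := (coroot e f).

Lemma wcoord0 n : crd n 0 = 0.
Proof. by rewrite /wcoord mulmx0 mxE. Qed.

Lemma wcoordZ n a x : crd n (a *: x) = a * crd n x.
Proof. by rewrite -[a *: x]addr0 wcoord_scalar wcoord0 addr0. Qed.

Lemma wcoordD n x y : crd n (x + y) = crd n x + crd n y.
Proof. by rewrite -[x]scale1r wcoord_scalar mul1r scale1r. Qed.

Lemma wcoord_sum n (I : Type) (r : seq I) (F : I -> V) :
  crd n (\sum_(i <- r) F i) = \sum_(i <- r) crd n (F i).
Proof.
elim/big_rec2: _ => [|i y1 y2 _ <-]; first exact: wcoord0.
by rewrite wcoordD.
Qed.

Lemma wcoord_coroot (n : 'I_27) i x : crd n (h i *m x) = (wt n i)%:~R * crd n x.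
Proof.
rewrite {1}(wcoord_decomposition char0 HV irrV Hvplus x) mulmx_sumr wcoord_sum.
rewrite (bigD1 n) //= big1 => [|m mn].
  rewrite -scalemxAr wcoordZ (coroot_weight_vector char0 HV Hvplus) // wcoordZ.
  by rewrite (wcoord_weight_vector char0 HV irrV Hvplus) eqxx mulr1 addr0 mulrC.
rewrite -scalemxAr wcoordZ (coroot_weight_vector char0 HV Hvplus) // wcoordZ.
by rewrite (wcoord_weight_vector char0 HV irrV Hvplus) eq_sym (negPf mn) !mulr0.
Qed.

Lemma wcoord_weight (c : 'I_6 -> int) (x : V) (n : 'I_27) :
  (forall i, h i *m x = (c i)%:~R *: x) -> crd n x != 0 ->
  forall i : 'I_6, wt n i = c i.
Proof.
move=> hx xn i; apply: (char0_intr_inj char0); apply: (mulIf xn).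
by rewrite -wcoord_coroot hx wcoordZ.
Qed.

Definition pairing (rho : {ffun 'I_6 -> int}) (i : 'I_6) : int :=
  \sum_j rho j * cartan i j.

Lemma root_space_act (rho : {ffun 'I_6 -> int}) (c : 'I_6 -> int) (x : M) (u : V) :
  root_space e f rho x -> (forall i, h i *m u = (c i)%:~R *: u) ->
  forall i, h i *m (x *m u) = (c i + pairing rho i)%:~R *: (x *m u).
Proof.
move=> [_ hx] hu i; rewrite bracket_actC hx hu -scalemxAl -scalemxAr -scalerDl.
by rewrite rmorphD /= addrC.
Qed.

Lemma root_space_wcoord (rho : {ffun 'I_6 -> int}) (x : M) (m n : 'I_27) :
  root_space e f rho x -> crd m (x *m v n) != 0 ->
  forall i : 'I_6, wt m i = wt n i + pairing rho i.
Proof.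
move=> Hx; apply: wcoord_weight.
apply: (root_space_act Hx) => i.
exact: (coroot_weight_vector char0 HV Hvplus).
Qed.

(** x^r shifts the i-th coordinate of a weight by r times the pairing, while two weights differ
    there by at most 2. *)
Lemma root_space_nilp (rho : {ffun 'I_6 -> int}) (x : M) r i :
  root_space e f rho x -> (2 < r * `|pairing rho i|)%N -> x ^+ r = 0.
Proof.
move=> Hx rp.
have xr0 (n : 'I_27) : x ^+ r *m v n = 0.
  apply: (wcoord_inj char0 HV irrV Hvplus) => m; rewrite wcoord0.
  apply: contrapT => /eqP nz.
  have hr s j : h j *m (x ^+ s *m v n) =
      (wt n j + pairing rho j *+ s)%:~R *: (x ^+ s *m v n).
    elim: s j => [|s IH] j.
      by rewrite mul1mx mulr0n addr0 (coroot_weight_vector char0 HV Hvplus).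
    by rewrite exprS mulmx_act (root_space_act Hx (IH)) mulrSr addrA.
  have E := wcoord_weight (hr r) nz i.
  have := abs_weight_le1 i (ltn_ord n); have := abs_weight_le1 i (ltn_ord m).
  move: E rp; rewrite -mulr_natr; move: (wt m i) (wt n i) (pairing rho i) => a b c.
  rewrite natz; nia.
apply/matrixP => a b; have E : x ^+ r *m delta_mx b 0 = 0 :> V.
  rewrite (wcoord_decomposition char0 HV irrV Hvplus (delta_mx b 0)) mulmx_sumr.
  by rewrite big1 // => n _; rewrite -scalemxAr xr0 scaler0.
by move/(congr1 (fun u : V => u a 0)): E; rewrite -colE !mxE.
Qed.

Lemma pairing_neq0 (rho : {ffun 'I_6 -> int}) : rho != 0 ->
  exists i, pairing rho i != 0.
Proof.
move=> nz; apply: contrapT => /forallNP H; case/eqP: nz.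
apply/ffunP => j; rewrite ffunE; apply: cartan_inj j => i.
by apply/eqP; move: (H i) => /negP; rewrite negbK.
Qed.

(** A root is only known to be nonzero, so some pairing is at least 1 in absolute value, whence the
    exponent 3. For simple roots the pairing 2 gives square zero in [expm_e] and [expm_f]. *)
Lemma root_space_cube0 (rho : {ffun 'I_6 -> int}) (x : M) :
  is_root e f rho -> root_space e f rho x -> x ^+ 3 = 0.
Proof.
move=> [/pairing_neq0[i ri] _] Hx; apply: (@root_space_nilp rho x 3 i) => //.
by move: (pairing rho i) ri => c; lia.
Qed.

Lemma root_subgroup_unit (rho : {ffun 'I_6 -> int}) :
  is_root e f rho -> root_subgroup e f rho `<=` [set g | g \is a GRing.unit].
Proof.
move=> Hr _ [x Hx <-] /=; have x3 := root_space_cube0 Hr Hx.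
have Nx3 : (- x) ^+ 3 = 0 by rewrite exprNn x3 mulr0.
apply/unitrP; exists (expm (- x)); split; last exact: expm_cube0_mulN.
by rewrite -{2}[x]opprK expm_cube0_mulN.
Qed.

Lemma is_subgroup_root_generated (A : set {ffun 'I_6 -> int}) :
  A `<=` is_root e f ->
  is_subgroup (group_generated (\bigcup_(rho in A) root_subgroup e f rho)).
Proof.
move=> AR; apply: is_subgroup_generated => g [rho Ar]; exact/root_subgroup_unit/AR.
Qed.

Lemma is_subgroup_G : is_subgroup (G e f).
Proof. exact: is_subgroup_root_generated. Qed.

Definition simple_root (s : int) (i : 'I_6) : {ffun 'I_6 -> int} :=
  [ffun j => (j == i)%:R * s].

Lemma pairing_simple_root s i j : pairing (simple_root s i) j = s * cartan j i.
Proof.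
rewrite /pairing (bigD1 i) //= big1 ?addr0 => [|l /negPf li].
  by rewrite ffunE eqxx mul1r.
by rewrite ffunE li !mul0r.
Qed.

Lemma e_root_space i t : root_space e f (simple_root 1 i) (t *: e i).
Proof.
split=> [|j]; first exact: lie_algebra_e.
rewrite -/(pairing _ _) pairing_simple_root mul1r /bracket -scalerAl -scalerAr.
by rewrite -scalerBr -/(bracket _ _) (cartan_e HV) !scalerA mulrC.
Qed.

Lemma f_root_space i t : root_space e f (simple_root (-1) i) (t *: f i).
Proof.
split=> [|j]; first exact: lie_algebra_f.
rewrite -/(pairing _ _) pairing_simple_root mulN1r /bracket -scalerAl -scalerAr.
by rewrite -scalerBr -/(bracket _ _) (cartan_f HV) !scalerA mulrC rmorphN.
Qed.

Lemma simple_root_neq0 s i : s != 0 -> simple_root s i != 0.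
Proof.
by apply: contra_neq => /ffunP/(_ i); rewrite !ffunE eqxx mul1r.
Qed.

Lemma exists_weight1 (i : 'I_6) : exists2 n, (n < 27)%N & wt n i = 1.
Proof.
have : all (fun i => has (fun n => wt n i == 1) (iota 0 27)) (iota 0 6) by vm_compute.
move=> /allP/(_ (nat_of_ord i)); rewrite mem_iota ltn_ord => /(_ isT)/hasP[n].
by rewrite mem_iota => n27 /eqP; exists n.
Qed.

Lemma weight_vector_neq0 n : (n < 27)%N -> v n != 0.
Proof.
move=> n27; apply/eqP => E; have := wcoord_weight_vector char0 HV irrV Hvplus
  (Ordinal n27) (Ordinal n27).
by rewrite /= E wcoord0 eqxx => /esym/eqP; rewrite oner_eq0.
Qed.

Lemma e_neq0 i : e i != 0.
Proof.
have [n n27 w] := exists_weight1 i.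
have /and3P[_ /implyP/(_ (introT eqP w))/and3P[m27 wm /eqP um] _] := weight_checkP i n27.
apply: contraTneq (weight_vector_neq0 n27) => E.
by have := e_weight_vector char0 HV Hvplus i m27; rewrite wm um E mul0mx => <-; rewrite eqxx.
Qed.

Lemma f_neq0 i : f i != 0.
Proof.
have [n n27 w] := exists_weight1 i.
have /and3P[_ /implyP/(_ (introT eqP w))/and3P[m27 _ _] _] := weight_checkP i n27.
apply: contraTneq (weight_vector_neq0 m27) => E.
by have := f_weight_vector char0 HV Hvplus i n27; rewrite w E mul0mx eqxx /= => <-; rewrite eqxx.
Qed.

Lemma e_is_root i : is_root e f (simple_root 1 i).
Proof.
split; first exact: simple_root_neq0.
exists (e i); rewrite e_neq0 -[X in root_space _ _ _ X]scale1r; split => //.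
exact: e_root_space.
Qed.

Lemma f_is_root i : is_root e f (simple_root (-1) i).
Proof.
split; first exact: simple_root_neq0.
exists (f i); rewrite f_neq0 -[X in root_space _ _ _ X]scale1r; split => //.
exact: f_root_space.
Qed.

Lemma expm_e i t : expm (t *: e i) = 1 + t *: e i.
Proof.
apply: expm_sqr0; apply: (@root_space_nilp _ _ _ i (e_root_space i t)).
by rewrite pairing_simple_root /cartan eqxx.
Qed.

Lemma expm_f i t : expm (t *: f i) = 1 + t *: f i.
Proof.
apply: expm_sqr0; apply: (@root_space_nilp _ _ _ i (f_root_space i t)).
by rewrite pairing_simple_root /cartan eqxx.
Qed.

Lemma x_pos_G i t : G e f (x_pos e i t).
Proof.
apply: sub_group_generated; exists (simple_root 1 i); first exact: e_is_root.
by exists (t *: e i); first exact: e_root_space.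
Qed.

Lemma x_neg_G i t : G e f (x_neg f i t).
Proof.
apply: sub_group_generated; exists (simple_root (-1) i); first exact: f_is_root.
by exists (t *: f i); first exact: f_root_space.
Qed.

(** Serves [parabolic_phi]: [phi] is multiplicative on [G] only. *)
Lemma B_sub_G : B e f `<=` G e f.
Proof.
have [_ GM GV] := is_subgroup_G.
have wG i t : G e f (w_simple e f i t).
  exact: GM (GM _ _ (x_pos_G _ _) (x_neg_G _ _)) (x_pos_G _ _).
apply: group_generated_min is_subgroup_G _ => g [|[rho [Hr _]] Hg].
  apply: group_generated_min is_subgroup_G _ g => _ [i [t [_ ->]]].
  by apply: GM => //; have [] := GV _ (wG i 1).
by apply: sub_group_generated; exists rho.
Qed.

End RootSpaces.

(* The entry of alpha 1 is empty because V_(alpha 1) is by definition a line. *)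
Definition component_table (d : nat) : seq nat :=
  nth [::] [:: [::]; [:: 0; 2; 3; 4; 5]; [:: 0]; [:: 0; 2]; [:: 0; 2; 3; 1];
               [:: 0; 2; 3; 4; 1]]%N d.

Definition supported (d n : nat) : bool :=
  all (fun j => j \in component_table d) (word n).

Definition edge_avoiding (d i j : nat) : bool :=
  [&& ((i.+1, j.+1) \in E6_edges) || ((j.+1, i.+1) \in E6_edges), i != d & j != d].

(** The table is closed under the remaining edges, so it contains the component. Conversely each
    entry other than 0 has a neighbour listed before it, and induction on the position connects it
    to alpha_1. *)
Lemma componentE (d i : 'I_6) : d != alpha 1 ->
  component d i = (nat_of_ord i \in component_table d).
Proof.
move=> d1; have d0 : (0 < d)%N.
  by rewrite lt0n; apply: contra_neq d1 => d0; apply: val_inj; rewrite /= d0 inordK.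
have dm : nat_of_ord d \in iota 1 5 by rewrite mem_iota d0 ltn_ord.
pose t := component_table d.
have tclosed : closed (fun i j : 'I_6 => [&& adjacent i j, i != d & j != d])
    [pred i : 'I_6 | nat_of_ord i \in t].
  have /allP/(_ _ dm)/allP H : all (fun d => all (fun i => all (fun j =>
     edge_avoiding d i j ==> ((i \in component_table d) == (j \in component_table d)))
     (iota 0 6)) (iota 0 6)) (iota 1 5) by vm_compute.
  move=> x y xy; have /allP/(_ y) := H x ltac:(by rewrite mem_iota /=).
  by rewrite mem_iota ltn_ord => /(_ isT)/implyP/(_ xy)/eqP.
have t0 : 0%N \in t.
  have /allP/(_ _ dm) // : all (fun d => 0%N \in component_table d) (iota 1 5).
  by vm_compute.
apply/idP/idP => [/(closed_connect tclosed)|].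
  by rewrite !inE /= inordK // t0 => <-.
have /allP/(_ _ dm)/allP H : all (fun d => let t := component_table d in
  all (fun i => (i == 0%N) || has (fun j => [&& (j < 6)%N, edge_avoiding d j i
    & (index j t < index i t)%N]) t) t) (iota 1 5) by vm_compute.
have [m] := ubnP (index (nat_of_ord i) t); elim: m i => // m IH i im it.
have /orP[/eqP i0|/hasP[j jt /and3P[j6 ji jlt]]] := H _ it.
  suff -> : i = alpha 1 by apply: connect0.
  by apply: val_inj; rewrite /= i0 inordK.
apply: connect_trans (IH (Ordinal j6) (leq_trans jlt im) jt) (connect1 _).
exact: ji.
Qed.

Lemma supported0 n : (n < 27)%N -> supported 0 n = (n == 0%N).
Proof.
have /allP H : all (fun n => supported 0 n == (n == 0%N)) (iota 0 27) by vm_compute.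
by move=> n27; apply/eqP/H; rewrite mem_iota.
Qed.

Lemma supported_mult (d n : nat) : (n < 27)%N ->
  reflect (forall j : 'I_6, nat_of_ord j \notin component_table d -> mult n j = 0)
    (supported d n).
Proof.
move=> n27; apply: (iffP allP) => [H j|H j jn].
  apply: contraNeq => jn; apply: H; move: jn.
  by rewrite /mult -has_pred1 has_count; case: (count _ _).
have j6 : (j < 6)%N.
  have /allP Hw : all (fun n => all (fun j => j < 6)%N (word n)) (iota 0 27).
    by vm_compute.
  by have /allP/(_ _ jn) := Hw n ltac:(by rewrite mem_iota).
apply: contraT => /(H (Ordinal j6)) /eqP.
by rewrite /mult /= eqz_nat -leqn0 leqNgt -has_count has_pred1 jn.
Qed.

(** By [cartan_inj] the multiplicities of m are those of n minus the coefficients of rho, and both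
    vanish outside the component. *)
Lemma supported_pairing (d : 'I_6) (rho : {ffun 'I_6 -> int}) (m n : 'I_27) :
  (forall j : 'I_6, rho j != 0 -> nat_of_ord j \in component_table d) ->
  (forall i : 'I_6, wt m i = wt n i + pairing rho i) ->
  supported d n -> supported d m.
Proof.
move=> Hr Hw /supported_mult nS; apply/supported_mult => // j jd.
have := @cartan_inj (fun j => rho j - mult n j + mult m j) _ j.
rewrite nS ?ltn_ord //.
have -> : rho j = 0 by apply: contraNeq jd; apply: Hr.
rewrite subr0 add0r; apply => i.
under eq_bigr do rewrite mulrDl mulrBl.
rewrite big_split sumrB /= -/(pairing rho i).
have := Hw i; rewrite !wt_mult //.
move: (\sum_j0 _) (\sum_j0 _) (pairing rho i) (_%:R) => a b c z; lia.
Qed.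

(** * V_delta as a coordinate subspace *)

Section StandardSubspaces.
Variables (k : fieldType) (char0 : [pchar k] =i pred0).
Variables (e f : 'I_6 -> 'M[k]_27) (HV : E6_module e f).
Hypothesis irrV : irreducible_module e f.
Variable vplus : 'cV[k]_27.
Hypothesis Hvplus : highest_weight_vector e f (alpha 1) vplus.
Local Notation v := (weight_vector f vplus).
Local Notation V := 'cV[k]_27.
Local Notation M := 'M[k]_27.
Local Notation crd := (wcoord f vplus).

Definition coordinate_subspace (S : pred nat) : set V :=
  [set x | forall n : 'I_27, ~~ S n -> crd n x = 0].

Lemma is_subspace_coordinate (S : pred nat) : is_subspace (coordinate_subspace S).
Proof.
split=> [n _|a x y Sx Sy n nS]; first exact: wcoord0.
by rewrite wcoordD wcoordZ Sx // Sy // mulr0 addr0.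
Qed.

Lemma coordinate_subspace_weight_vector (S : pred nat) (n : 'I_27) :
  S n -> coordinate_subspace S (v n).
Proof.
move=> Sn m mS; rewrite (wcoord_weight_vector char0 HV irrV Hvplus).
by case: eqP => // mn; rewrite mn Sn in mS.
Qed.

Lemma wcoord_act (x : M) (u : V) (m : 'I_27) :
  crd m (x *m u) = \sum_n crd n u * crd m (x *m v n).
Proof.
rewrite {1}(wcoord_decomposition char0 HV irrV Hvplus u) mulmx_sumr wcoord_sum.
by apply: eq_bigr => n _; rewrite -scalemxAr wcoordZ.
Qed.

Lemma root_space_coordinate_subspace (d : 'I_6) (rho : {ffun 'I_6 -> int}) (x : M) :
  (forall j : 'I_6, rho j != 0 -> nat_of_ord j \in component_table d) ->
  root_space e f rho x -> forall u, coordinate_subspace (supported d) u ->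
  coordinate_subspace (supported d) (x *m u).
Proof.
move=> Hr Hx u Hu m mS; rewrite wcoord_act big1 // => n _.
have [nS|nS] := boolP (supported d n); last by rewrite Hu ?mul0r.
have [->|nz] := eqVneq (crd m (x *m v n)) 0; first by rewrite mulr0.
have Hw := root_space_wcoord char0 HV irrV Hvplus Hx nz.
by rewrite (supported_pairing Hr Hw nS) in mS.
Qed.

Lemma expm_coordinate_subspace (x : M) (S : pred nat) : x ^+ 3 = 0 ->
  (forall u, coordinate_subspace S u -> coordinate_subspace S (x *m u)) ->
  forall u, coordinate_subspace S u -> coordinate_subspace S (expm x *m u).
Proof.
move=> x3 xS u Su n nS; rewrite expm_cube0 // !mulmxDl mul1mx -scalemxAl expr2.
rewrite mulmx_act !wcoordD wcoordZ Su // (xS _ Su) // (xS _ (xS _ Su)) //.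
by rewrite mulr0 !addr0.
Qed.

(** Stability under the inverse is built into [H] to make it a subgroup; for a generator it is
    stability under [expm (- x)]. *)
Lemma L_coordinate_subspace (d : 'I_6) (g : M) : d != alpha 1 -> L e f d g ->
  forall u, coordinate_subspace (supported d) u ->
  coordinate_subspace (supported d) (g *m u).
Proof.
move=> d1; pose U := coordinate_subspace (supported d).
pose H : set M := [set g | [/\ g \is a GRing.unit, forall u, U u -> U (g *m u)
   & forall u, U u -> U (g^-1 *m u)]].
suff LH : L e f d `<=` H by move/LH => [].
apply: group_generated_min => [|_ [rho [Hr Hd] [x Hx <-]]].
  split; first by split=> [|u|u]; rewrite ?unitr1 ?invr1 ?mul1mx.
    move=> a b [au aU aV] [bu bU bV]; split; first by rewrite unitrMl.
      by move=> u Uu; rewrite mulmx_act; apply: aU; apply: bU.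
    by move=> u Uu; rewrite invrM // mulmx_act; apply: bV; apply: aV.
  by move=> a [au aU aV]; split=> //; split; rewrite ?unitrV ?invrK.
have x3 := root_space_cube0 char0 HV irrV Hvplus Hr Hx.
have Nx3 : (- x) ^+ 3 = 0 by rewrite exprNn x3 mulr0.
have eu : expm x \is a GRing.unit.
  by apply: (root_subgroup_unit char0 HV irrV Hvplus Hr); exists x.
have xU : forall u, U u -> U (x *m u).
  apply: root_space_coordinate_subspace Hx => j /Hd.
  by rewrite componentE.
split=> //; first exact: expm_coordinate_subspace.
have -> : (expm x)^-1 = expm (- x).
  by apply: (mulrI eu); rewrite mulrV // expm_cube0_mulN.
apply: expm_coordinate_subspace => // u Uu; rewrite mulNmx -scaleN1r.
have [U0 UZD] := is_subspace_coordinate (supported d).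
by have := UZD (-1) _ _ (xU _ Uu) U0; rewrite addr0.
Qed.

(** The group recovers the lowering operators: f i u = (1 + f i) u - u, where 1 + f i = exp (f i)
    lies in [L]. *)
Lemma weight_vector_orbit_span (d : 'I_6) (w : seq nat) : d != alpha 1 ->
  all (fun j => j \in component_table d) w ->
  Defs.span [set g *m vplus | g in L e f d]
    (foldr (fun j u => f (inord j) *m u) vplus w).
Proof.
move=> d1; set S := Defs.span _.
have Lsub : is_subgroup (L e f d).
  by apply: (is_subgroup_root_generated char0 HV irrV Hvplus) => rho [].
have [S0 SZD] : is_subspace S by apply: is_subspace_span.
elim: w => [_|j w IH /=].
  by apply: subset_span; exists 1; rewrite ?mul1mx //; case: Lsub.
case/andP => jd /IH; set u := foldr _ _ _ => Su; set i : 'I_6 := inord j.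
have j6 : (j < 6)%N.
  have /allP/(_ (nat_of_ord d)) : all (fun d =>
    all (fun j => j < 6)%N (component_table d)) (iota 0 6) by vm_compute.
  by rewrite mem_iota ltn_ord => /(_ isT)/allP; apply.
have Li : L e f d (1 + 1 *: f i).
  rewrite -(expm_f char0 HV irrV Hvplus).
  apply: sub_group_generated; exists (simple_root (-1) i).
    split=> [|l]; first exact: (f_is_root char0 HV irrV Hvplus).
    rewrite ffunE componentE //; have [->|] := eqVneq l i; last by rewrite mul0r eqxx.
    by rewrite inordK.
  by exists (1 *: f i); first exact: f_root_space.
have SL g : L e f d g -> forall y, S y -> S (g *m y).
  move=> Lg y; apply: (@span_minimal _ _ _ [set y | S (g *m y)]).
    split; first by rewrite /= mulmx0.
    by move=> a x z Sx Sz; rewrite /= mulmxDr -scalemxAr; apply: SZD.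
  move=> _ [g' Lg' <-] /=; rewrite -mulmx_act; apply: subset_span; exists (g * g') => //.
  by have [_ LM _] := Lsub; apply: LM.
have -> : f i *m u = (- 1) *: u + (1 + 1 *: f i) *m u.
  by rewrite scale1r mulmxDl mul1mx scaleN1r addKr.
by apply: SZD => //; apply: SL.
Qed.

Lemma VsubE (d : 'I_6) : Vsub e f vplus d = coordinate_subspace (supported d).
Proof.
rewrite /Vsub; have [->|d1] := eqVneq d (alpha 1).
  have a0 : alpha 1 = 0%N :> nat by rewrite /= inordK.
  rewrite a0; apply/seteqP; split=> [_ [a _ <-] n|x xS].
    rewrite supported0 // => n0.
    have := wcoord_weight_vector char0 HV irrV Hvplus n ord0; rewrite wcoordZ => ->.
    by rewrite -val_eqE /= (negPf n0) mulr0.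
  exists (crd ord0 x) => //.
  rewrite [RHS](wcoord_decomposition char0 HV irrV Hvplus x) (bigD1 ord0) //=.
  rewrite big1 ?addr0 // => n n0; rewrite xS ?scale0r // supported0 //.
apply/seteqP; split.
  apply: span_minimal (is_subspace_coordinate _) _ => _ [g Lg <-].
  apply: L_coordinate_subspace Lg _ _ => //.
  exact: (coordinate_subspace_weight_vector (n := ord0)).
move=> x xS; rewrite [x](wcoord_decomposition char0 HV irrV Hvplus).
have [S0 SZD] := is_subspace_span [set g *m vplus | g in L e f d].
elim/big_ind: _ => // [a b Sa Sb|n _]; first by rewrite -[a]scale1r; apply: SZD.
have [nS|/xS ->] := boolP (supported d n); last by rewrite scale0r.
by rewrite -[_ *: _]addr0; apply: SZD => //; apply: weight_vector_orbit_span.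
Qed.

End StandardSubspaces.

(** * Structure constants of the brace product *)

Definition sigma_nat (i : nat) : nat := nth 0%N [:: 5; 1; 4; 3; 2; 0]%N i.

Lemma sigmaE (i : 'I_6) : sigma i = sigma_nat i :> nat.
Proof.
rewrite /sigma permM /alpha !permE /= -!val_eqE /= !inordK //.
by case: i => [[|[|[|[|[|[|//]]]]]] i6]; rewrite /sigma_nat /= -?val_eqE /= ?inordK.
Qed.

Lemma sigmaK (i : 'I_6) : sigma (sigma i) = i.
Proof.
apply: val_inj; rewrite /= !sigmaE.
by case: i => [[|[|[|[|[|[|//]]]]]] i6].
Qed.

(** The number of minus the sigma-twist of the n-th weight. Since b is invariant up to phi, v n can
    pair nontrivially only with v (dual n). *)
Definition dual_table : seq nat := Eval vm_compute in
  [seq index [seq - wt n (sigma_nat i) | i <- iota 0 6] weights | n <- iota 0 27].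

Definition dual (n : nat) : nat := nth 27 dual_table n.

Lemma dual_check n (i : 'I_6) : (n < 27)%N ->
  [/\ (dual n < 27)%N, dual (dual n) = n & wt (dual n) i = - wt n (sigma i)].
Proof.
have /allP H : all (fun n => all (fun i => [&& (dual n < 27)%N, dual (dual n) == n &
  wt (dual n) i == - wt n (sigma_nat i)]) (iota 0 6)) (iota 0 27) by vm_compute.
move=> n27; have /allP/(_ (nat_of_ord i)) := H n ltac:(by rewrite mem_iota).
by rewrite mem_iota ltn_ord => /(_ isT)/and3P[-> /eqP-> /eqP->]; rewrite sigmaE.
Qed.

(** The value of b (v n) (v (dual n)) relative to b (v 0) (v 26): each lowering operator moved
    across b costs a sign. *)
Definition depth_sign (n : nat) : int := (-1) ^+ size (word n).

Lemma depth_sign_sqr n : depth_sign n * depth_sign n = 1.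
Proof. by rewrite -expr2 sqrr_sign. Qed.

(** The number of the weight completing those of a and b to total weight zero; it is 27 if there is
    none, and then v a # v b = 0. *)
Definition third (a b : nat) : nat :=
  index [seq - wt a i - wt b i | i <- iota 0 6] weights.

(* Moving a lowering operator from the first, or else from the second, argument
   of an invariant cubic form to another one brings every triple of weight
   vectors of total weight zero to (0, 12, 26); 0 is returned on failure. *)
Fixpoint cubic_sign (fuel a b c : nat) : int :=
  if fuel is fuel'.+1 then
    if [seq i <- iota 0 6 | wt a i == -1] is i :: _ then
      if (wt b i == 1) && (wt c i == 0) then - cubic_sign fuel' (up a i) (dn b i) c
      else if (wt b i == 0) && (wt c i == 1) then - cubic_sign fuel' (up a i) b (dn c i)
      else 0
    else if [seq i <- iota 0 6 | (wt b i == -1) && (wt a i == 0)] is i :: _ then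
      if wt c i == 1 then - cubic_sign fuel' a (up b i) (dn c i) else 0
    else [&& a == 0, b == 12 & c == 26]%N%:R
  else 0.

(** Among the basis vectors v a # v b pairs only with v q, so it is a multiple of v (dual q). The
    depth sign, its own inverse, divides out b (v (dual q)) (v q). [sharp_basisE] checks that fuel
    30 never leads to the failure value 0. *)
Definition sharp_entry (a b : nat) : seq (nat * int) :=
  let q := third a b in
  if (q < 27)%N then [:: (dual q, depth_sign (dual q) * cubic_sign 30 a b q)] else [::].

Definition sharp_table : seq (seq (seq (nat * int))) :=
  Eval vm_compute in [seq [seq sharp_entry a b | b <- iota 0 27] | a <- iota 0 27].

Definition sharp_basis (a b : nat) : seq (nat * int) :=
  nth [::] (nth [::] sharp_table a) b.

(** The brace of three basis vectors divided by b (v 0) (v 26), a factor of the last term too by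
    [ratio_sqr]. Terms with the same index are not collected; [coefficient] adds them up. *)
Definition brace_basis (a b c : nat) : seq (nat * int) :=
  (if b == dual a then [:: (c, depth_sign a)] else [::]) ++
  (if b == dual c then [:: (a, depth_sign c)] else [::]) ++
  flatten [seq [seq (q.1, - (p.2 * q.2)) | q <- sharp_basis p.1 b]
          | p <- sharp_basis a c].

Definition coefficient (l : seq (nat * int)) (n : nat) : int :=
  foldr (fun p s => if p.1 == n then p.2 + s else s) 0 l.

Lemma sharp_basisE a b : (a < 27)%N -> (b < 27)%N ->
  sharp_basis a b = sharp_entry a b /\
  ((third a b < 27)%N -> cubic_sign 30 a b (third a b) != 0).
Proof.
have /allP H : all (fun a => all (fun b => (sharp_basis a b == sharp_entry a b) &&
  ((third a b < 27)%N ==> (cubic_sign 30 a b (third a b) != 0))) (iota 0 27))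
  (iota 0 27) by vm_compute.
move=> a27 b27; have /allP/(_ b) := H a ltac:(by rewrite mem_iota).
by rewrite mem_iota => /(_ b27)/andP[/eqP -> /implyP].
Qed.

Lemma sharp_basis_bounded a b : all (fun p => p.1 < 27)%N (sharp_basis a b).
Proof.
have : all (all (all (fun p => p.1 < 27)%N)) sharp_table by vm_compute.
move=> /(all_nthP [::])/(_ a); rewrite /sharp_basis.
case: ltnP => [_ /(_ isT)|aT _]; last by rewrite [nth _ _ a]nth_default // nth_nil.
move=> /(all_nthP [::])/(_ b).
by case: ltnP => [_ /(_ isT)|bT _] //; rewrite nth_default.
Qed.

Lemma brace_basis_bounded a b c : (a < 27)%N -> (c < 27)%N ->
  all (fun p => p.1 < 27)%N (brace_basis a b c).
Proof.
move=> a27 c27; rewrite !all_cat; apply/and3P; split.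
- by case: ifP => //=; rewrite c27.
- by case: ifP => //=; rewrite a27.
apply/allP => q /flattenP[_ /mapP[p _ ->] /mapP[r rs ->]] /=.
exact: allP (sharp_basis_bounded _ _) _ rs.
Qed.

Lemma coefficient_notin l n : n \notin unzip1 l -> coefficient l n = 0.
Proof.
elim: l => //= p l IH; rewrite inE negb_or eq_sym => /andP[/negPf -> /IH //].
Qed.

(** The finite check behind V_(sigma d) being contained in psi V_d. Only indices occurring in the
    list are tested, the others having coefficient 0. *)
Lemma brace_basis_supported (d : 'I_6) (a b c m : 'I_27) :
  supported d a -> supported (sigma d) b -> ~~ supported d m ->
  coefficient (brace_basis a b c) m = 0.
Proof.
have /allP H : all (fun d => all (fun a => supported d a ==>
   all (fun b => supported (sigma_nat d) b ==> all (fun c =>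
     let l := brace_basis a b c in
     all (fun m => supported d m || (coefficient l m == 0)) (unzip1 l))
   (iota 0 27)) (iota 0 27)) (iota 0 27)) (iota 0 6) by vm_compute.
move=> Sa Sb Sm; have [ml|] := boolP (nat_of_ord m \in unzip1 (brace_basis a b c));
  last exact: coefficient_notin.
have /allP/(_ (nat_of_ord a)) := H d ltac:(by rewrite mem_iota /=).
rewrite Sa mem_iota ltn_ord => /(_ isT)/allP/(_ (nat_of_ord b)).
rewrite -sigmaE Sb mem_iota ltn_ord => /(_ isT)/allP/(_ (nat_of_ord c)).
rewrite mem_iota ltn_ord => /(_ isT)/allP/(_ _ ml).
by rewrite (negPf Sm) => /eqP.
Qed.

(** The first triple (a, c, m) found for each d and b. The default (0, 0, 0) concerns only the b
    supported for sigma d, for which no triple exists. *)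
Definition unsupported_witnesses : seq (seq (nat * nat * nat)) := Eval vm_compute in
  [seq [seq head (0, 0, 0)%N
    [seq (q, m) | q <- [seq (a, c) | a <- [seq a <- iota 0 27 | supported d a],
                                     c <- iota 0 27],
       m <- let l := brace_basis q.1 b q.2 in
            [seq m <- unzip1 l | ~~ supported d m && (coefficient l m != 0)]]
  | b <- iota 0 27] | d <- iota 0 6].

(** The m-th coordinate of {v a, y, v c} is then a nonzero multiple of the b-th coordinate of y,
    which must vanish for y in psi V_d. Only one b can contribute, its weight being determined by
    those of a, c and m. *)
Lemma brace_basis_unsupported (d : 'I_6) (b : 'I_27) : ~~ supported (sigma d) b ->
  exists a c m : 'I_27, [/\ supported d a, ~~ supported d m,
    coefficient (brace_basis a b c) m != 0
    & forall b' : 'I_27, b' != b -> coefficient (brace_basis a b' c) m = 0].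
Proof.
have /allP H : all (fun d => all (fun b => supported (sigma_nat d) b ||
   let: (a, c, m) := nth (0, 0, 0)%N (nth [::] unsupported_witnesses d) b in
   [&& (a < 27)%N, (c < 27)%N, (m < 27)%N, supported d a, ~~ supported d m,
       coefficient (brace_basis a b c) m != 0
     & all (fun b' => (b' == b) || (coefficient (brace_basis a b' c) m == 0))
          (iota 0 27)])
   (iota 0 27)) (iota 0 6) by vm_compute.
have /allP/(_ (nat_of_ord b)) := H d ltac:(by rewrite mem_iota /=).
rewrite mem_iota ltn_ord -sigmaE => /(_ isT) + Sb; rewrite (negPf Sb).
case: (nth _ _ _) => -[a c] m /and5P[a27 c27 m27 Sa /and3P[Sm nz /allP uniq]].
exists (Ordinal a27), (Ordinal c27), (Ordinal m27); split=> // b' nb.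
have := uniq b'; rewrite mem_iota ltn_ord => /(_ isT)/orP[|/eqP //].
by move=> /eqP/val_inj E; rewrite E eqxx in nb.
Qed.

(** * The invariant forms *)

Section ScalarMaps.
Variables (k : fieldType) (W : lmodType k).

Lemma scalar_form0 (F : W -> k) : scalar F -> F 0 = 0.
Proof. by move=> Fl; have := Fl (-1) 0 0; rewrite scaler0 addr0 mulN1r addNr. Qed.

Lemma scalar_formD (F : W -> k) x y : scalar F -> F (x + y) = F x + F y.
Proof. by move=> Fl; have := Fl 1 x y; rewrite scale1r mul1r. Qed.

Lemma scalar_formZ (F : W -> k) a x : scalar F -> F (a *: x) = a * F x.
Proof. by move=> Fl; have := Fl a x 0; rewrite addr0 scalar_form0 // addr0. Qed.

Lemma scalar_form_sum (F : W -> k) (I : finType) (c : I -> k) (x : I -> W) :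
  scalar F -> F (\sum_i c i *: x i) = \sum_i c i * F (x i).
Proof.
move=> Fl; elim/big_rec2: _ => [|i y1 y2 _ <-]; first exact: scalar_form0.
by rewrite Fl.
Qed.
End ScalarMaps.

Section Forms.
Variables (k : fieldType) (char0 : [pchar k] =i pred0).
Variables (e f : 'I_6 -> 'M[k]_27) (HV : E6_module e f).
Hypothesis irrV : irreducible_module e f.
Variable vplus : 'cV[k]_27.
Hypothesis Hvplus : highest_weight_vector e f (alpha 1) vplus.
Local Notation v := (weight_vector f vplus).
Local Notation V := 'cV[k]_27.
Local Notation M := 'M[k]_27.
Local Notation crd := (wcoord f vplus).
Local Notation h := (coroot e f).

Variables (phi : M -> M) (Hphi : diagram_automorphism e f phi).
Variables (b : V -> V -> k) (Hb : phi_invariant_bilinear e f phi b).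

(** * The bilinear form on weight vectors *)

Lemma bDl x y z : b (x + y) z = b x z + b y z.
Proof. exact: scalar_formD (bilinear_l Hb z). Qed.
Lemma bDr x y z : b x (y + z) = b x y + b x z.
Proof. exact: scalar_formD (bilinear_r Hb x). Qed.
Lemma bZl a x z : b (a *: x) z = a * b x z.
Proof. exact: scalar_formZ (bilinear_l Hb z). Qed.
Lemma bZr a x z : b x (a *: z) = a * b x z.
Proof. exact: scalar_formZ (bilinear_r Hb x). Qed.
Lemma b0l z : b 0 z = 0.
Proof. exact: scalar_form0 (bilinear_l Hb z). Qed.
Lemma bNl x z : b (- x) z = - b x z.
Proof. by rewrite -scaleN1r bZl mulN1r. Qed.
Lemma bNr x z : b x (- z) = - b x z.
Proof. by rewrite -scaleN1r bZr mulN1r. Qed.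

(** Invariance reads t A + t^2 C = 0 for all t, and the difference of the values at 1 and -1 is 2
    A. *)
Lemma b_infinitesimal (X Y : M) :
  (forall t x y, b ((1 + t *: X) *m x) ((1 + t *: Y) *m y) = b x y) ->
  forall x y, b (X *m x) y = - b x (Y *m y).
Proof.
move=> H x y.
have E t : t * b (X *m x) y + t * b x (Y *m y) + t * t * b (X *m x) (Y *m y) = 0.
  have := H t x y; rewrite !mulmxDl !mul1mx -!scalemxAl !(bDl, bDr, bZl, bZr) => E.
  by apply: (addrI (b x y)); rewrite addr0 -[RHS]E; ring.
have : 2%:R * (b (X *m x) y + b x (Y *m y)) = 0.
  by rewrite -[RHS](subrr 0) -{1}(E 1) -{1}(E (-1)); ring.
by move/eqP; rewrite mulf_eq0 (negPf (two_neq0 char0)) addr_eq0 => /eqP.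
Qed.

Lemma b_e i x y : b (e (sigma i) *m x) y = - b x (e i *m y).
Proof.
apply: b_infinitesimal => t x' y'; rewrite -!(expm_e char0 HV irrV Hvplus).
rewrite -[expm (t *: e i)]/(x_pos e i t) -[expm _]/(x_pos e (sigma i) t).
rewrite -(phi_pos Hphi); apply: (bilinear_inv Hb).
exact: (x_pos_G char0 HV irrV Hvplus).
Qed.

Lemma b_f i x y : b (f (sigma i) *m x) y = - b x (f i *m y).
Proof.
apply: b_infinitesimal => t x' y'; rewrite -!(expm_f char0 HV irrV Hvplus).
rewrite -[expm (t *: f i)]/(x_neg f i t) -[expm _]/(x_neg f (sigma i) t).
rewrite -(phi_neg Hphi); apply: (bilinear_inv Hb).
exact: (x_neg_G char0 HV irrV Hvplus).
Qed.

Lemma b_coroot i x y : b (h (sigma i) *m x) y = - b x (h i *m y).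
Proof.
rewrite !bracket_act bDl bNl !(b_e, b_f) bDr bNr; ring.
Qed.

Lemma b_weight m n : (m < 27)%N -> (n < 27)%N -> n != dual m -> b (v m) (v n) = 0.
Proof.
move=> m27 n27; apply: contra_neq_eq => nz.
have [dm _ _] := dual_check ord0 m27.
apply: wt_inj => // i; have [_ _ ->] := dual_check i m27.
have := b_coroot i (v m) (v n).
rewrite !(coroot_weight_vector char0 HV Hvplus) // bZl bZr -mulNr => /(mulIf nz).
rewrite -rmorphN => /(char0_intr_inj char0) ->; lia.
Qed.

Local Notation c := (b (v 0) (v 26)).

Lemma b_dual (m : nat) : (m < 27)%N -> b (v m) (v (dual m)) = (depth_sign m)%:~R * c.
Proof.
elim/ltn_ind: m => -[_ _|m0 IH m27]; first by rewrite mul1r.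
have /allP/(_ m0.+1) : all (fun m => let j := head 0%N (word m) in
   let p := index (behead (word m)) words in
   [&& (j < 6)%N, (p < m)%N, word m == j :: word p, wt (dual m) (sigma_nat j) == 1
     & dn (dual m) (sigma_nat j) == dual p]) (iota 1 26) by vm_compute.
rewrite mem_iota => /(_ m27)/and5P[].
set m := m0.+1 in IH m27 *; set j := head _ _; set p := index _ _.
move=> j6 pm /eqP wordm wd /eqP dd.
pose i : 'I_6 := inord j; have iE : i = j :> nat by rewrite inordK.
have [d27 _ _] := dual_check ord0 m27.
(* The index is written as [sigma (sigma i)] to fit [b_f], which moves the operator to the second
   argument and turns v (dual m) into v (dual p). *)
have -> : v m = f (sigma (sigma i)) *m v p by rewrite sigmaK /weight_vector wordm.
rewrite b_f (f_weight_vector char0 HV Hvplus) // sigmaE iE wd dd.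
rewrite (IH p pm (ltn_trans pm m27)) /depth_sign wordm /= exprS mulN1r rmorphN.
by rewrite mulNr.
Qed.

Lemma b_coord x (m : 'I_27) :
  b x (v (dual m)) = crd m x * ((depth_sign m)%:~R * c).
Proof.
have [dm dK _] := dual_check ord0 (ltn_ord m).
rewrite {1}(wcoord_decomposition char0 HV irrV Hvplus x).
rewrite (scalar_form_sum _ _ (bilinear_l Hb _)) (bigD1 m) //= b_dual // big1 ?addr0 //.
move=> n nm; rewrite b_weight ?mulr0 //.
apply: contra_neq nm => /(congr1 dual); rewrite dK.
by have [_ -> _] := dual_check ord0 (ltn_ord n) => /val_inj.
Qed.

Lemma b_top_neq0 : c != 0.
Proof.
have [x [y]] := bilinear_neq0 Hb; apply: contraNneq => c0.
rewrite (wcoord_decomposition char0 HV irrV Hvplus y).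
rewrite (scalar_form_sum _ _ (bilinear_r Hb _)) big1 // => n _.
have [dn dK _] := dual_check ord0 (ltn_ord n).
by have := b_coord x (Ordinal dn); rewrite /= dK c0 !mulr0 => ->; rewrite mulr0.
Qed.

Lemma depth_sign_neq0 m : (depth_sign m)%:~R != 0 :> k.
Proof.
apply/eqP => E; have := depth_sign_sqr m; move/(congr1 (fun z : int => z%:~R : k)).
by rewrite /= intrM E mulr0 => /esym/eqP; rewrite oner_eq0.
Qed.

Lemma b_nondegenerate x x' : (forall y, b x y = b x' y) -> x = x'.
Proof.
move=> E; apply: (wcoord_inj char0 HV irrV Hvplus) => m.
have /mulIf : (depth_sign m)%:~R * c != 0 by rewrite mulf_neq0 ?depth_sign_neq0 ?b_top_neq0.
by apply; rewrite -!b_coord.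
Qed.

Variables (N : V -> k) (N3 : V -> V -> V -> k) (HN : invariant_cubic e f N N3).

(** * The cubic form on weight vectors *)

Lemma N3D x y z w : N3 x y (z + w) = N3 x y z + N3 x y w.
Proof. exact: scalar_formD (cubic_linear HN x y). Qed.
Lemma N3Z a x y z : N3 x y (a *: z) = a * N3 x y z.
Proof. exact: scalar_formZ (cubic_linear HN x y). Qed.
Lemma N3_0 x y : N3 x y 0 = 0.
Proof. exact: scalar_form0 (cubic_linear HN x y). Qed.
Let s12 := cubic_sym12 HN.
Let s23 := cubic_sym23 HN.
Lemma N3D2 x y z w : N3 x (z + w) y = N3 x z y + N3 x w y.
Proof. by rewrite s23 N3D !(s23 x y). Qed.
Lemma N3D1 x y z w : N3 (z + w) x y = N3 z x y + N3 w x y.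
Proof. by rewrite s12 N3D2 !(s12 x). Qed.
Lemma N3Z2 a x y z : N3 x (a *: z) y = a * N3 x z y.
Proof. by rewrite s23 N3Z (s23 x y). Qed.
Lemma N3Z1 a x y z : N3 (a *: z) x y = a * N3 z x y.
Proof. by rewrite s12 N3Z2 (s12 x). Qed.
Lemma N3_02 x y : N3 x 0 y = 0.
Proof. by rewrite s23 N3_0. Qed.
Lemma N3_01 x y : N3 0 x y = 0.
Proof. by rewrite s12 N3_02. Qed.

Lemma six_neq0 : 6%:R != 0 :> k.
Proof. by apply/eqP => E; have := @char0_natr_inj k char0 6 0 E. Qed.

Lemma N3_polarization x y z : 6%:R * N3 x y z =
  6%:R * (N (x + y + z) - N (x + y) - N (y + z) - N (x + z) + N x + N y + N z).
Proof.
rewrite !(mulrDr, mulrN) -!(cubic_polar HN) !(N3D, N3D2, N3D1).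
(* Brings the arguments of each [N3] into one order, so that [ring] identifies equal terms. *)
rewrite ?(s23 _ z y) ?(s23 _ z x) ?(s23 _ y x) ?(s12 z) ?(s12 y x).
rewrite ?(s23 _ z y) ?(s23 _ z x) ?(s23 _ y x) ?(s12 y x).
ring.
Qed.

Lemma N3_inv g x y z : G e f g -> N3 (g *m x) (g *m y) (g *m z) = N3 x y z.
Proof.
move=> Gg; apply: (mulfI six_neq0); rewrite !N3_polarization -!mulmxDr.
by rewrite !(cubic_inv HN) .
Qed.

Lemma N3_infinitesimal (X : M) :
  (forall t, G e f (1 + t *: X)) ->
  forall x y z, N3 (X *m x) y z + N3 x (X *m y) z + N3 x y (X *m z) = 0.
Proof.
move=> GX x y z.
pose A1 := N3 (X *m x) y z + N3 x (X *m y) z + N3 x y (X *m z).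
pose A2 := N3 (X *m x) (X *m y) z + N3 (X *m x) y (X *m z) + N3 x (X *m y) (X *m z).
pose A3 := N3 (X *m x) (X *m y) (X *m z).
have E t : t * A1 + t ^+ 2 * A2 + t ^+ 3 * A3 = 0.
  have := N3_inv x y z (GX t); rewrite !mulmxDl !mul1mx -!scalemxAl.
  rewrite !(N3D, N3D2, N3D1) !(N3Z, N3Z1, N3Z2) => E.
  by apply: (addrI (N3 x y z)); rewrite addr0 -[RHS]E /A1 /A2 /A3; ring.
apply: (mulfI six_neq0); rewrite mulr0 -/A1.
(* The values at t = 1, -1, 2 with weights 6, -2, -1 cancel the terms in t^2 and t^3 and leave 6
   A1. *)
have -> : 6%:R * A1 = 6%:R * (1 * A1 + 1 ^+ 2 * A2 + 1 ^+ 3 * A3)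
   - 2%:R * ((-1) * A1 + (-1) ^+ 2 * A2 + (-1) ^+ 3 * A3)
   - (2%:R * A1 + 2%:R ^+ 2 * A2 + 2%:R ^+ 3 * A3) by ring.
by rewrite !E; ring.
Qed.

Lemma N3_e i x y z : N3 (e i *m x) y z + N3 x (e i *m y) z + N3 x y (e i *m z) = 0.
Proof.
apply: N3_infinitesimal => t; rewrite -(expm_e char0 HV irrV Hvplus).
exact: (x_pos_G char0 HV irrV Hvplus).
Qed.

Lemma N3_f i x y z : N3 (f i *m x) y z + N3 x (f i *m y) z + N3 x y (f i *m z) = 0.
Proof.
apply: N3_infinitesimal => t; rewrite -(expm_f char0 HV irrV Hvplus).
exact: (x_neg_G char0 HV irrV Hvplus).
Qed.

(** Operators that annihilate N3 as derivations are closed under the bracket: in ef - fe the mixed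
    terms cancel. *)
Lemma N3_coroot i x y z : N3 (h i *m x) y z + N3 x (h i *m y) z + N3 x y (h i *m z) = 0.
Proof.
have E1 := N3_e i (f i *m x) y z; have E2 := N3_e i x (f i *m y) z.
have E3 := N3_e i x y (f i *m z); have F1 := N3_f i (e i *m x) y z.
have F2 := N3_f i x (e i *m y) z; have F3 := N3_f i x y (e i *m z).
rewrite !bracket_act !(N3D, N3D1, N3D2) -!scaleN1r !(N3Z, N3Z1, N3Z2).
transitivity ((0 + 0 + 0) - (0 + 0 + 0) : k); last by ring.
rewrite -{1}E1 -{1}E2 -{1}E3 -{1}F1 -{1}F2 -F3; ring.
Qed.

Lemma N3_weight (p q r : 'I_27) (i : 'I_6) :
  wt p i + wt q i + wt r i != 0 -> N3 (v p) (v q) (v r) = 0.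
Proof.
apply: contra_neq_eq => nz; have := N3_coroot i (v p) (v q) (v r).
rewrite !(coroot_weight_vector char0 HV Hvplus) // N3Z N3Z1 N3Z2 -!mulrDl => /eqP.
rewrite mulf_eq0 (negPf nz) orbF -!rmorphD => /eqP E.
exact: (@char0_intr_inj _ char0 _ 0 E).
Qed.

Local Notation n := (N3 (v 0) (v 12) (v 26)).

Lemma weight_up p (i : 'I_6) : (p < 27)%N -> wt p i = -1 ->
  (up p i < 27)%N /\ v p = f i *m v (up p i).
Proof.
move=> p27 w; have /and3P[_ _] := weight_checkP i p27.
rewrite w /= => /and4P[-> _ _ _]; split=> //.
by have [_ _ + _] := weight_vectorP char0 HV Hvplus p27; apply.
Qed.

Lemma weight_dn p (i : 'I_6) : (p < 27)%N -> wt p i = 1 ->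
  (dn p i < 27)%N /\ f i *m v p = v (dn p i).
Proof.
move=> p27 w; have /and3P[_ + _] := weight_checkP i p27.
rewrite w /= => /and3P[-> _ _]; split=> //.
by rewrite (f_weight_vector char0 HV Hvplus) // w.
Qed.

Lemma f_weight0 p (i : 'I_6) : (p < 27)%N -> wt p i = 0 -> f i *m v p = 0.
Proof. by move=> p27 w; rewrite (f_weight_vector char0 HV Hvplus) // w. Qed.

#[local] Arguments filter : simpl never.
#[local] Arguments iota : simpl never.

(** Each recursive step is [N3_f] with one argument raised, the operator killing one of the other
    two arguments and lowering the remaining one. The hypothesis excludes the failure value 0. *)
Lemma cubic_signP fuel p q r : (p < 27)%N -> (q < 27)%N -> (r < 27)%N ->
  cubic_sign fuel p q r != 0 ->
  N3 (v p) (v q) (v r) = (cubic_sign fuel p q r)%:~R * n.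
Proof.
elim: fuel p q r => // fuel IH p q r p27 q27 r27 /=.
case Ep: [seq i <- iota 0 6 | wt p i == -1] => [|i s]; last first.
  have : i \in [seq i <- iota 0 6 | wt p i == -1] by rewrite Ep mem_head.
  rewrite mem_filter mem_iota => /andP[/eqP wp /= i6].
  have [u27 vp] := weight_up (i := Ordinal i6) p27 wp.
  have E := N3_f (Ordinal i6) (v (up p i)) (v q) (v r); rewrite -vp in E.
  case: ifP => [/andP[/eqP wq /eqP wr]|_].
    rewrite oppr_eq0 => nz; have [d27 vq] := weight_dn (i := Ordinal i6) q27 wq.
    move: E; rewrite vq (f_weight0 (i := Ordinal i6) r27 wr) N3_0 addr0 => /eqP.
    by rewrite addr_eq0 => /eqP ->; rewrite IH // rmorphN mulNr.
  case: ifP => [/andP[/eqP wq /eqP wr]|_]; last by rewrite eqxx.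
  rewrite oppr_eq0 => nz; have [d27 vr] := weight_dn (i := Ordinal i6) r27 wr.
  move: E; rewrite vr (f_weight0 (i := Ordinal i6) q27 wq) N3_02 addr0 => /eqP.
  by rewrite addr_eq0 => /eqP ->; rewrite IH // rmorphN mulNr.
case Eq: [seq i <- iota 0 6 | (wt q i == -1) && (wt p i == 0)] => [|i s].
  by case: and3P => [[/eqP-> /eqP-> /eqP->] _|_]; rewrite ?mul1r ?eqxx.
have : i \in [seq i <- iota 0 6 | (wt q i == -1) && (wt p i == 0)] by rewrite Eq mem_head.
rewrite mem_filter mem_iota => /andP[/andP[/eqP wq /eqP wp] /= i6].
case: ifP => [/eqP wr|_]; last by rewrite eqxx.
rewrite oppr_eq0 => nz; have [u27 vq] := weight_up (i := Ordinal i6) q27 wq.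
have [d27 vr] := weight_dn (i := Ordinal i6) r27 wr.
have := N3_f (Ordinal i6) (v p) (v (up q i)) (v r).
rewrite -vq vr (f_weight0 (i := Ordinal i6) p27 wp) N3_01 add0r => /eqP.
by rewrite addr_eq0 => /eqP ->; rewrite IH // rmorphN mulNr.
Qed.

Lemma N3_third (p q s : 'I_27) : third p q != s -> N3 (v p) (v q) (v s) = 0.
Proof.
apply: contra_neq_eq => nz.
have W (i : 'I_6) : - wt p i - wt q i = wt s i.
  have /eqP : wt p i + wt q i + wt s i == 0.
    by apply: contra_neqT nz; apply: N3_weight.
  lia.
have -> : third p q = index (nth [::] weights s) weights.
  have /allP/(_ (nat_of_ord s)) : all (fun n =>
    nth [::] weights n == [seq wt n i | i <- iota 0 6]) (iota 0 27) by vm_compute.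
  rewrite mem_iota ltn_ord => /(_ isT)/eqP ->; congr index.
  by apply/eq_in_map => i; rewrite mem_iota => /= i6; apply: (W (Ordinal i6)).
by rewrite index_uniq.
Qed.

Variables (sharp : V -> V -> V) (Hsharp : forall x y z, b (sharp x y) z = N3 x y z).
Hypothesis Hadjoint : forall x, adjoint sharp (adjoint sharp x) = N x *: x.

(** * The product # and its scalar factor *)

Lemma sharpC x y : sharp x y = sharp y x.
Proof. by apply: b_nondegenerate => z; rewrite !Hsharp s12. Qed.

Lemma sharp_linear a x x' y : sharp (a *: x + x') y = a *: sharp x y + sharp x' y.
Proof.
by apply: b_nondegenerate => z; rewrite bDl bZl !Hsharp N3D1 N3Z1.
Qed.

Lemma sharpD x x' y : sharp (x + x') y = sharp x y + sharp x' y.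
Proof. by rewrite -[x]scale1r sharp_linear !scale1r. Qed.

Lemma sharp0 y : sharp 0 y = 0.
Proof. by apply: (addrI (sharp 0 y)); rewrite -sharpD !addr0. Qed.

Lemma sharpZ a x y : sharp (a *: x) y = a *: sharp x y.
Proof. by rewrite -[a *: x]addr0 sharp_linear sharp0 addr0. Qed.

Lemma sharpDr x y y' : sharp x (y + y') = sharp x y + sharp x y'.
Proof. by rewrite sharpC sharpD !(sharpC x). Qed.

Lemma sharpZr a x y : sharp x (a *: y) = a *: sharp x y.
Proof. by rewrite sharpC sharpZ sharpC. Qed.

Local Notation r := (n / c).

Definition evaluation (l : seq (nat * int)) : V :=
  \sum_(p <- l) p.2%:~R *: v p.1.

Lemma evaluation1 m z : evaluation [:: (m, z)] = z%:~R *: v m.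
Proof. exact: big_seq1. Qed.

Lemma b_basis_inj x x' : (forall s : 'I_27, b x (v s) = b x' (v s)) -> x = x'.
Proof.
move=> E; apply: b_nondegenerate => y.
rewrite (wcoord_decomposition char0 HV irrV Hvplus y).
rewrite !(scalar_form_sum _ _ (bilinear_r Hb _)).
by apply: eq_bigr => s _; rewrite E.
Qed.

Lemma sharp_basisP (p q : nat) : (p < 27)%N -> (q < 27)%N ->
  sharp (v p) (v q) = r *: evaluation (sharp_basis p q).
Proof.
move=> p27 q27; apply: b_basis_inj => s; rewrite Hsharp bZl.
have [-> nz] := sharp_basisE p27 q27; rewrite /sharp_entry.
have [t27|t27] := ltnP (third p q) 27; last first.
  rewrite /evaluation big_nil b0l mulr0 (@N3_third (Ordinal p27) (Ordinal q27)) //.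
  by apply: contraTneq t27 => ->; rewrite -ltnNge.
have [d27 dK _] := dual_check ord0 t27.
rewrite evaluation1 bZl; have [E|ne] := eqVneq (third p q) s; last first.
  rewrite (@N3_third (Ordinal p27) (Ordinal q27)) //.
  rewrite (@b_weight (dual (third p q)) s) ?mulr0 //.
  by rewrite /= dK eq_sym.
have bt : b (v (dual (third p q))) (v (third p q)) =
    (depth_sign (dual (third p q)))%:~R * c by rewrite -b_dual // dK.
rewrite -E bt (cubic_signP _ _ _ (nz t27)) // intrM.
move: (cubic_sign _ _ _ _) => w.
have zz : (depth_sign (dual (third p q)))%:~R *
    (depth_sign (dual (third p q)))%:~R = 1 :> k.
  by rewrite -intrM depth_sign_sqr.
move: n c b_top_neq0 (_%:~R) zz => n' c' c0 z zz.
transitivity ((z * z) * (w%:~R * (n' / c' * c'))); last by ring.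
by rewrite zz mul1r divfK.
Qed.

(** Otherwise # vanishes on the basis, hence everywhere, and N x = b (x # x) x / 6 would be zero. *)
Lemma ratio_neq0 : r != 0.
Proof.
have [x Nx] := cubic_neq0 HN; apply: contraNneq Nx => r0.
suff /(congr1 (b^~ x)) : sharp x x = 0.
  by rewrite Hsharp b0l (cubic_polar HN) => /eqP; rewrite mulf_eq0 (negPf six_neq0).
have decomposition := wcoord_decomposition char0 HV irrV Hvplus.
have S1 (p : 'I_27) : sharp x (v p) = 0.
  rewrite {1}[x]decomposition.
  elim/big_ind: _ => [|y z y0 z0|q _]; rewrite ?sharp0 // ?sharpD ?y0 ?z0 ?addr0 //.
  by rewrite sharpZ sharp_basisP // r0 scale0r scaler0.
rewrite {2}[x]decomposition sharpC.
elim/big_ind: _ => [|y z y0 z0|p _]; rewrite ?sharp0 // ?sharpD ?y0 ?z0 ?addr0 //.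
by rewrite sharpZ sharpC S1 scaler0.
Qed.

(** For the sum x one gets x^# = r x and 6 N x = b (x # x) x = 6 r c. The adjoint identity then
    reads r^3 x = r c x. *)
Lemma ratio_sqr_of_triple (u0 u1 u2 : V) :
  sharp u0 u0 = 0 -> sharp u1 u1 = 0 -> sharp u2 u2 = 0 ->
  sharp u0 u1 = r *: u0 -> sharp u0 u2 = r *: u1 -> sharp u1 u2 = r *: u2 ->
  b (u0 + u1 + u2) (u0 + u1 + u2) = 3%:R * c -> u0 + u1 + u2 != 0 -> r * r = c.
Proof.
move=> s00 s11 s22 s01 s02 s12'; set x := u0 + u1 + u2 => bxx x0.
have sharpx : sharp x x = (2%:R * r) *: x.
  rewrite !(sharpD, sharpDr) (sharpC u1 u0) (sharpC u2 u0) (sharpC u2 u1).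
  rewrite s00 s11 s22 s01 s02 s12' /x; move: r => z.
  by apply/colP => i; rewrite !mxE; ring.
have adjx : adjoint sharp x = r *: x.
  by rewrite /adjoint sharpx scalerA mulKf // two_neq0.
have Nx : N x = r * c.
  apply: (mulfI six_neq0); rewrite -(cubic_polar HN) -Hsharp sharpx bZl bxx.
  by move: r => z; move: c => d; ring.
have := Hadjoint x; rewrite adjx /adjoint sharpZ sharpZr sharpx Nx.
rewrite !scalerA => /eqP; rewrite -subr_eq0 -scalerBl scaler_eq0 (negPf x0) orbF.
rewrite subr_eq0; move: ratio_neq0; move: r => z; move: c => d z0 /eqP E; apply: (mulfI z0).
rewrite -E; transitivity (2%:R^-1 * 2%:R * (z * (z * z))); last by ring.
by rewrite mulVf ?mul1r // two_neq0.
Qed.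

(* The adjoint identity at v 0 + v 12 + v 26 determines b in terms of N. *)
Lemma ratio_sqr : r * r = c.
Proof.
have ev m : evaluation [:: (m, 1%Z)] = v m by rewrite evaluation1 scale1r.
have sh p q : (p < 27)%N -> (q < 27)%N ->
    sharp (v p) (v q) = r *: evaluation (sharp_basis p q) by exact: sharp_basisP.
have nil : evaluation [::] = 0 by rewrite /evaluation big_nil.
apply: (@ratio_sqr_of_triple (v 0) (v 12) (v 26)).
- by rewrite (sh 0 0)%N // nil scaler0.
- by rewrite (sh 12 12)%N // nil scaler0.
- by rewrite (sh 26 26)%N // nil scaler0.
- by rewrite (sh 0 12)%N // ev.
- by rewrite (sh 0 26)%N // ev.
- by rewrite (sh 12 26)%N // ev.
(* [dual] exchanges 0 and 26 and fixes 12; the depths 16 and 8 are even, so both signs are 1. *)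
- have b26 : b (v 26) (v 0) = c := etrans (b_dual (isT : 26 < 27)%N) (mul1r _).
  have b12 : b (v 12) (v 12) = c := etrans (b_dual (isT : 12 < 27)%N) (mul1r _).
  have bv p q : (p < 27)%N -> (q < 27)%N -> q != dual p -> b (v p) (v q) = 0.
    exact: b_weight.
  have Z := (bv 0 0 isT isT isT, bv 0 12 isT isT isT, bv 12 0 isT isT isT,
    bv 12 26 isT isT isT, bv 26 12 isT isT isT, bv 26 26 isT isT isT)%N.
  move: (v 0) (v 12) (v 26) b26 b12 Z => u0 u1 u2 b26 b12 Z.
  by rewrite !(bDl, bDr) b26 b12 !Z; ring.
- apply/eqP => /(congr1 (crd ord0)); rewrite !wcoordD wcoord0.
  have v0 (m : 'I_27) := wcoord_weight_vector char0 HV irrV Hvplus ord0 m.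
  rewrite (v0 ord0) (v0 (@Ordinal 27 12 isT)) (v0 (@Ordinal 27 26 isT)) !addr0.
  by move/eqP; rewrite oner_eq0.
Qed.

Lemma evaluation_cat l1 l2 : evaluation (l1 ++ l2) = evaluation l1 + evaluation l2.
Proof. exact: big_cat. Qed.

Lemma wcoord_evaluation (l : seq (nat * int)) (m : 'I_27) :
  all (fun p => p.1 < 27)%N l -> crd m (evaluation l) = (coefficient l m)%:~R.
Proof.
rewrite /evaluation; elim: l => [|[p z] l IH] /=; first by rewrite big_nil wcoord0.
case/andP => p27 /IH {}IH; rewrite big_cons wcoordD wcoordZ IH.
rewrite (wcoord_weight_vector char0 HV irrV Hvplus m (Ordinal p27)) -val_eqE /= eq_sym.
by case: eqP => _; rewrite ?mulr1 ?mulr0 ?add0r // rmorphD.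
Qed.

Lemma sharp_evaluation (l : seq (nat * int)) q : (q < 27)%N ->
  all (fun p => p.1 < 27)%N l ->
  sharp (evaluation l) (v q) = r *: evaluation
    (flatten [seq [seq (s.1, p.2 * s.2) | s <- sharp_basis p.1 q] | p <- l]).
Proof.
move=> q27; rewrite /evaluation; elim: l => [|p l IH] /=.
  by rewrite !big_nil sharp0 scaler0.
case/andP => p27 /IH {}IH; rewrite big_cons big_cat sharpD sharpZ sharp_basisP // IH.
rewrite scalerDr; congr (_ + _); rewrite /evaluation big_map !scaler_sumr.
apply: eq_bigr => s _ /=; rewrite !scalerA intrM; congr (_ *: _).
by move: r => z; ring.
Qed.

(** * The brace product and psi on the standard subspaces *)

Local Notation brc := (brace b sharp).

Lemma brace_basisP p q s : (p < 27)%N -> (q < 27)%N -> (s < 27)%N ->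
  brc (v p) (v q) (v s) = c *: evaluation (brace_basis p q s).
Proof.
move=> p27 q27 s27; rewrite /brace /brace_basis !evaluation_cat !scalerDr -addrA.
have E (m m' : nat) : (m < 27)%N -> b (v m) (v q) *: v m' =
    c *: evaluation (if q == dual m then [:: (m', depth_sign m)] else [::]).
  move=> m27; case: eqP => [->|/eqP ne]; last first.
    by rewrite b_weight // scale0r /evaluation big_nil scaler0.
  by rewrite b_dual // evaluation1 scalerA mulrC.
congr (_ + _); [exact: E|congr (_ + _); [exact: E|]].
rewrite sharp_basisP // sharpZ sharp_evaluation ?sharp_basis_bounded //.
rewrite scalerA ratio_sqr -scalerN; congr (_ *: _).
rewrite /evaluation !big_flatten !big_map -sumrN; apply: eq_bigr => x _.
rewrite !big_map -sumrN; apply: eq_bigr => y _ /=.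
by rewrite rmorphN scaleNr.
Qed.

Lemma wcoordN (m : 'I_27) x : crd m (- x) = - crd m x.
Proof. by rewrite -scaleN1r wcoordZ mulN1r. Qed.

Lemma brace_scalar1 (m : 'I_27) y z : scalar (fun x => crd m (brc x y z)).
Proof.
move=> a x x'; rewrite /brace bDl bZl !(sharpD, sharpZ).
by rewrite !(wcoordD, wcoordZ, wcoordN); ring.
Qed.

Lemma brace_scalar2 (m : 'I_27) x z : scalar (fun y => crd m (brc x y z)).
Proof.
move=> a y y'; rewrite /brace !(bDr, bZr) !(sharpDr, sharpZr).
by rewrite !(wcoordD, wcoordZ, wcoordN); ring.
Qed.

Lemma brace_scalar3 (m : 'I_27) x y : scalar (fun z => crd m (brc x y z)).
Proof.
move=> a z z'; rewrite /brace !(bDl, bZl) !(sharpDr, sharpZr, sharpD, sharpZ).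
by rewrite !(wcoordD, wcoordZ, wcoordN); ring.
Qed.

Lemma wcoord_brace_vector (m p s : 'I_27) y :
  crd m (brc (v p) y (v s)) =
  \sum_q crd q y * (c * (coefficient (brace_basis p q s) m)%:~R).
Proof.
rewrite {1}(wcoord_decomposition char0 HV irrV Hvplus y).
rewrite (scalar_form_sum _ _ (brace_scalar2 m _ _)); apply: eq_bigr => q _.
by rewrite brace_basisP // wcoordZ wcoord_evaluation ?brace_basis_bounded.
Qed.

Lemma psi_coordinate_subspace (d : 'I_6) :
  psi b sharp (coordinate_subspace f vplus (supported d)) =
  coordinate_subspace f vplus (supported (sigma d)).
Proof.
have decomposition := wcoord_decomposition char0 HV irrV Hvplus.
apply/seteqP; split=> y Hy.
  move=> q /brace_basis_unsupported[p [s [m [Sp Sm nz uniq]]]].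
  have := Hy (v p) (v s) (coordinate_subspace_weight_vector char0 HV irrV Hvplus Sp) m Sm.
  rewrite wcoord_brace_vector (bigD1 q) //= big1 => [|q' ne]; last first.
    by rewrite uniq // !mulr0.
  rewrite addr0 => /eqP; rewrite !mulf_eq0 (negPf b_top_neq0) /=.
  case/orP => [/eqP //|/eqP E]; case/eqP: nz.
  exact: (@char0_intr_inj _ char0 _ 0 E).
move=> x z Hx m Sm; rewrite [x]decomposition (scalar_form_sum _ _ (brace_scalar1 m _ _)).
apply: big1 => p _; have [Sp|/Hx ->] := boolP (supported d p); last by rewrite mul0r.
rewrite [z]decomposition (scalar_form_sum _ _ (brace_scalar3 m _ _)).
rewrite big1 ?mulr0 // => s _; rewrite wcoord_brace_vector big1 ?mulr0 // => q _.
have [Sq|/Hy ->] := boolP (supported (sigma d) q); last by rewrite mul0r.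
by rewrite (brace_basis_supported s Sp Sq Sm) !mulr0.
Qed.

Lemma psi_Vsub (d : 'I_6) :
  psi b sharp (Vsub e f vplus d) = Vsub e f vplus (sigma d).
Proof. by rewrite !(VsubE char0 HV irrV Hvplus) psi_coordinate_subspace. Qed.

(** * Equivariance of psi and the geometry *)

Local Notation G := (G e f).
Let Gsub : is_subgroup G := is_subgroup_G char0 HV irrV Hvplus.

Lemma G_mul g g' : G g -> G g' -> G (g * g').
Proof. by have [_ H _] := Gsub; apply: H. Qed.
Lemma G_one : G 1. Proof. by have [] := Gsub. Qed.
Lemma G_unit g : G g -> g \is a GRing.unit.
Proof. by have [_ _ H] := Gsub; case/H. Qed.
Lemma G_inv g : G g -> G g^-1.
Proof. by have [_ _ H] := Gsub; case/H. Qed.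

Lemma phi_one : phi 1 = 1.
Proof.
have G1 := G_one; have u := G_unit (phi_G Hphi G1).
by apply: (mulrI u); rewrite -(phi_mul Hphi) // !mulr1.
Qed.

Lemma phi_inv g : G g -> phi g^-1 = (phi g)^-1.
Proof.
move=> Gg; have pu := G_unit (phi_G Hphi Gg).
apply: (mulrI pu); rewrite -(phi_mul Hphi Gg (G_inv Gg)) [RHS]divrr //.
by rewrite [g * _]divrr ?phi_one //; apply: G_unit.
Qed.

Lemma mulmxVK_act (g : M) (x : V) : g \is a GRing.unit -> g *m (g^-1 *m x) = x.
Proof. by move=> gu; rewrite -mulmx_act divrr // mul1mx. Qed.

Lemma mulmxK_act (g : M) (x : V) : g \is a GRing.unit -> g^-1 *m (g *m x) = x.
Proof. by move=> gu; rewrite -mulmx_act mulVr // mul1mx. Qed.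

(** The twist by phi comes from b, which pairs [phi g] in the first argument with [g] in the
    second. *)
Lemma sharp_act g x y : G g -> sharp (g *m x) (g *m y) = phi g *m sharp x y.
Proof.
move=> Gg; apply: b_nondegenerate => z; rewrite -(mulmxVK_act z (G_unit Gg)).
by rewrite Hsharp N3_inv // (bilinear_inv Hb) // Hsharp.
Qed.

(** Invariance of b is read at [phi g], and the two nested # twist by phi twice; both use that phi
    is an involution. *)
Lemma brace_act g x y z : G g ->
  brc (g *m x) (phi g *m y) (g *m z) = g *m brc x y z.
Proof.
move=> Gg; have Gp := phi_G Hphi Gg.
have bE u w : b (g *m u) (phi g *m w) = b u w.
  by rewrite -{1}(phi_invol Hphi Gg) (bilinear_inv Hb).
rewrite /brace !bE sharp_act // sharp_act // (phi_invol Hphi Gg).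
by rewrite mulmxBr mulmxDr !scalemxAr.
Qed.

Lemma psi_act g X : G g -> psi b sharp (Defs.act g X) = Defs.act (phi g) (psi b sharp X).
Proof.
move=> Gg; have gu := G_unit Gg; have pu := G_unit (phi_G Hphi Gg).
apply/seteqP; split=> [y Hy|_ [y Hy <-] _ z [x Xx <-]].
  exists ((phi g)^-1 *m y); last exact: mulmxVK_act.
  move=> x z Xx; have := Hy (g *m x) (g *m z).
  rewrite -{1}(mulmxVK_act y pu) brace_act // => -[]; first by exists x.
  by move=> w Xw /(congr1 (mulmx g^-1)); rewrite !mulmxK_act // => <-.
rewrite -(mulmxVK_act z gu) brace_act //.
by exists (brc x y (g^-1 *m z)) => //; apply: Hy.
Qed.

Lemma psi_object X : object e f vplus X ->
  object e f vplus (psi b sharp X) /\ psi b sharp (psi b sharp X) = X.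
Proof.
move=> [g [d [Gg ->]]]; have Gp := phi_G Hphi Gg.
rewrite psi_act // psi_Vsub; split; first by exists (phi g), (sigma d).
by rewrite psi_act // psi_Vsub sigmaK (phi_invol Hphi Gg).
Qed.

Lemma psi_stabilizer X g : stabilizer e f X g -> stabilizer e f (psi b sharp X) (phi g).
Proof.
by move=> [Gg gX]; split; [exact: phi_G Hphi _ Gg|rewrite -psi_act // gX].
Qed.

Lemma stabilizer_psi X : object e f vplus X ->
  stabilizer e f (psi b sharp X) = phi @` stabilizer e f X.
Proof.
move=> OX; apply/seteqP; split=> [g sg|_ [g sg <-]]; last exact: psi_stabilizer.
exists (phi g); last by apply: (phi_invol Hphi); case: sg.
by have := psi_stabilizer sg; have [_ ->] := psi_object OX.
Qed.

(** Since phi preserves B, it carries the conjugate of B by g to the conjugate of B by phi g. *)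
Lemma parabolic_phi P : parabolic e f P -> parabolic e f (phi @` P).
Proof.
move=> [[P1 PM PV] PG [g Gg BP]]; split.
- split; first by exists 1; [exact: P1|exact: phi_one].
    move=> _ _ [x Px <-] [y Py <-]; exists (x * y); first exact: PM Px Py.
    by rewrite (phi_mul Hphi) //; apply: PG.
  move=> _ [x Px <-]; split; first exact: G_unit (phi_G Hphi (PG _ Px)).
  exists x^-1; first by case: (PV _ Px).
  exact: phi_inv (PG _ Px).
- by move=> _ [x Px <-]; exact: phi_G Hphi _ (PG _ Px).
exists (phi g); first exact: phi_G Hphi _ Gg.
move=> _ [x Bx <-]; have : (phi @` B e f) x by rewrite (phi_B Hphi).
move=> [y By <-]; have Gy := B_sub_G char0 HV irrV Hvplus By.
have Gi := G_inv Gg.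
exists (g * y * g^-1); first by apply: BP; exists y.
by rewrite !(phi_mul Hphi) ?phi_inv //; apply: G_mul.
Qed.

Lemma incident_psi X Y : incident e f X Y ->
  incident e f (psi b sharp X) (psi b sharp Y).
Proof.
move=> [P Ppar PXY]; exists (phi @` P); first exact: parabolic_phi.
by move=> _ [x /PXY[sX sY] <-]; split; apply: psi_stabilizer.
Qed.

Lemma psi_geometry_automorphism : geometry_automorphism e f vplus (psi b sharp).
Proof.
split; first split.
- by move=> X OX; exact: proj1 (psi_object OX).
- move=> X Y /set_mem OX /set_mem OY E.
  by have [_ <-] := psi_object OX; have [_ <-] := psi_object OY; rewrite E.
- by move=> X OX; have [OpX ppX] := psi_object OX; exists (psi b sharp X).
move=> X Y OX OY; split; last exact: incident_psi.
by move/incident_psi; have [_ ->] := psi_object OX; have [_ ->] := psi_object OY.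
Qed.

Lemma psi_induced_by : induced_by e f vplus phi (psi b sharp).
Proof.
move=> X OX; split; first exact: proj1 (psi_object OX).
exact: stabilizer_psi.
Qed.

End Forms.

Local Close Scope classical_set_scope.

Theorem mainTheorem2 (k : fieldType) (char0 : [pchar k] =i pred0)
    (e f : 'I_6 -> 'M[k]_27) (HV : E6_module e f)
    (irrV : irreducible_module e f)
    (vplus : 'cV[k]_27) (Hvplus : highest_weight_vector e f (alpha 1) vplus)
    (phi : 'M[k]_27 -> 'M[k]_27) (Hphi : diagram_automorphism e f phi)
    (b : 'cV[k]_27 -> 'cV[k]_27 -> k) (Hb : phi_invariant_bilinear e f phi b)
    (N : 'cV[k]_27 -> k) (N3 : 'cV[k]_27 -> 'cV[k]_27 -> 'cV[k]_27 -> k)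
    (HN : invariant_cubic e f N N3)
    (sharp : 'cV[k]_27 -> 'cV[k]_27 -> 'cV[k]_27)
    (Hsharp : forall x y z, b (sharp x y) z = N3 x y z)
    (Hadjoint : forall x, adjoint sharp (adjoint sharp x) = N x *: x) :
  (forall delta : 'I_6,
      psi b sharp (Vsub e f vplus delta) = Vsub e f vplus (sigma delta)) /\
  geometry_automorphism e f vplus (psi b sharp) /\
  induced_by e f vplus phi (psi b sharp).
Proof.
split; last split.
- exact: (psi_Vsub char0 HV irrV Hvplus Hphi Hb HN Hsharp Hadjoint).
- exact: (psi_geometry_automorphism char0 HV irrV Hvplus Hphi Hb HN Hsharp Hadjoint).
- exact: (psi_induced_by char0 HV irrV Hvplus Hphi Hb HN Hsharp Hadjoint).
Qed.
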